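(* As $N\to\infty$, \[ S(N)=\sqrt{N}\, \exp\Bigl\{\Bigl(-\frac{1}{\sqrt{2}}+o(1)\Bigr)\sqrt{\log N \log\log N}\Bigr\} . \]
   Context: For a positive integer $N$, $S(N)$ denotes the Sidon constant for the set of frequencies $\{\log n:\ n \text{ a positive integer},\ n\le N\}$, i.e. the smallest constant $C$ such that \[ \sum_{n=1}^N |a_n| \le C \sup_{t\in\mathbb{R}}\Bigl|\sum_{n=1}^N a_n n^{-it}\Bigr| \] holds for every Dirichlet polynomial $Q(s)=\sum_{n=1}^N a_n n^{-s}$ with complex coefficients $a_1,\dots,a_N$. *)

(* Defs.v *)
From mathcomp Require Import all_boot all_order all_algebra.
From mathcomp Require Import all_classical all_reals all_analysis.
From mathcomp Require Import complex ring.

Set Implicit Arguments.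
Unset Strict Implicit.
Unset Printing Implicit Defensive.

Import Order.TTheory GRing.Theory Num.Theory.
Import numFieldNormedType.Exports.
Import Normc.

Local Open Scope classical_set_scope.
Local Open Scope ring_scope.
Local Open Scope complex_scope.

Definition cexp (R : realType) (z : R[i]) : R[i] :=
  let: x +i* y := z in (expR x * cos y) +i* (expR x * sin y).

(* n^(-s) is exp (- s log n); only a 1, ..., a N contribute. *)
Definition dirichlet_poly (R : realType) (N : nat) (a : nat -> R[i])
    (s : R[i]) : R[i] :=
  \sum_(1 <= n < N.+1) a n * cexp (- s * (ln n%:R)%:C).

(* The values are bounded by \sum_n |a_n|, so this is a genuine supremum. *)
Definition sup_imag_axis (R : realType) (N : nat) (a : nat -> R[i]) : R :=
  sup [set normc (dirichlet_poly N a (0 +i* t)) | t in [set: R]].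

Definition sidon_bounds (R : realType) (N : nat) : set R :=
  [set C | forall a : nat -> R[i],
     \sum_(1 <= n < N.+1) normc (a n) <= C * sup_imag_axis N a].
Arguments sidon_bounds : clear implicits.

(* For 0 < N the infimum is attained; see sidon_least. *)
Definition sidon (R : realType) (N : nat) : R := inf (sidon_bounds R N).

Section SidonLeast.
Variable R : realType.
Implicit Types (N : nat) (a : nat -> R[i]) (z : R[i]).

Lemma normc_ge0 z : 0 <= normc z.
Proof. by case: z => x y; exact: sqrtr_ge0. Qed.

Lemma normc_sum (I : Type) (r : seq I) (P : pred I) (F : I -> R[i]) :
  normc (\sum_(i <- r | P i) F i) <= \sum_(i <- r | P i) normc (F i).
Proof.
elim/big_ind2: _ => [|x1 x2 y1 y2 h1 h2|//]; first by rewrite normc0.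
exact: le_trans (le_normcD _ _) (lerD h1 h2).
Qed.

Lemma cexp0 : cexp (0 : R[i]) = 1.
Proof. by rewrite /cexp /= expR0 cos0 sin0 mulr1 mulr0. Qed.

Lemma cexpD (z1 z2 : R[i]) : cexp (z1 + z2) = cexp z1 * cexp z2.
Proof.
case: z1 z2 => [x1 y1] [x2 y2]; rewrite /cexp /= expRD cosD sinD.
by congr Complex; ring.
Qed.

Lemma cexpMn z k : cexp (z *+ k) = cexp z ^+ k.
Proof.
by elim: k => [|k IHk]; rewrite ?cexp0 // mulrS cexpD IHk exprS.
Qed.

Lemma dirichlet_arg t (n : nat) :
  - (0 +i* t) * (ln n%:R)%:C = 0 +i* (- (t * ln n%:R)) :> R[i].
Proof.
apply/eqP; rewrite eq_complex /=.
by rewrite !(oppr0, mul0r, mulr0, subr0, add0r, mulNr) !eqxx.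
Qed.

Lemma normc_cexp_im (y : R) : normc (cexp (0 +i* y)) = 1.
Proof. by rewrite /normc /cexp expR0 !mul1r cos2Dsin2 sqrtr1. Qed.

Lemma has_sup_imag_axis N a :
  has_sup [set normc (dirichlet_poly N a (0 +i* t)) | t in [set: R]].
Proof.
split; first by exists (normc (dirichlet_poly N a (0 +i* 0))), 0.
exists (\sum_(1 <= n < N.+1) normc (a n)) => _ [t _ <-].
apply: le_trans (normc_sum _ _ _) _; apply: ler_sum => n _.
by rewrite normcM dirichlet_arg normc_cexp_im mulr1.
Qed.

Lemma le_sup_imag_axis N a (t : R) :
  normc (dirichlet_poly N a (0 +i* t)) <= sup_imag_axis N a.
Proof. by apply: sup_upper_bound; [exact: has_sup_imag_axis|exists t]. Qed.

Lemma sup_imag_axis_ge0 N a : 0 <= sup_imag_axis N a.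
Proof. exact: le_trans (normc_ge0 _) (le_sup_imag_axis N a 0). Qed.

Lemma sidon_bounds_ge0 N : (0 < N)%N -> lbound (sidon_bounds R N) 0.
Proof.
move=> N0 C /(_ (fun n => if n == 1%N then 1 else 0)).
rewrite big_ltn // big_nat big1; last first.
  by move=> n /andP[n1 _]; rewrite gtn_eqF // normc0.
rewrite eqxx normc1 addr0 => h; rewrite leNgt; apply/negP => C0.
have := lt_le_trans ltr01 h; apply/negP; rewrite -leNgt.
by apply: mulr_le0_ge0; [exact: ltW|exact: sup_imag_axis_ge0].
Qed.

(* The a_n are recovered by inverting a Vandermonde system from the values at
   i j h, j < N, where h is small enough to separate the frequencies. *)
Lemma sidon_bounds_nonempty N : (0 < N)%N -> sidon_bounds R N !=set0.
Proof.
move=> N0; pose h : R := (ln N.+1%:R)^-1.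
have lnN : 0 < ln N.+1%:R :> R by apply: ln_gt0; rewrite ltr1n.
pose w : 'rV[R[i]]_N := \row_i cexp (0 +i* (- (h * ln i.+1%:R))).
pose V : 'M[R[i]]_N := Vandermonde N w.
have Vu : V \in unitmx.
  rewrite unitmxE det_Vandermonde unitfE; apply/prodf_neq0 => i _.
  apply/prodf_neq0 => j ij; rewrite subr_eq0 !mxE; apply/eqP => -[].
  rewrite !expR0 !mul1r !cosN => cE _; move: ij.
  have rng (k : 'I_N) : h * ln k.+1%:R \in `[0, pi]%R.
    rewrite in_itv /= mulr_ge0 ?invr_ge0 ?(ltW lnN) ?ln_ge0 ?ler1n //=.
    apply: (@le_trans _ _ 1); last first.
      by apply: le_trans (pi_ge2 R); rewrite ler1n.
    rewrite /h mulrC ler_pdivrMr // mul1r ler_ln ?posrE ?ltr0n // ler_nat.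
    exact: leqW.
  have hN0 : h != 0 by rewrite invr_eq0 gt_eqF.
  have /(mulfI hN0) := cos_inj (rng j) (rng i) cE.
  move/ln_inj; rewrite !posrE !ltr0n => /(_ isT isT)/eqP.
  by rewrite eqr_nat eqSS => /eqP ->; rewrite ltnn.
exists (\sum_(i < N) \sum_(j < N) normc (invmx V i j)) => a.
rewrite big_add1 big_mkord mulr_suml; apply: ler_sum => i _.
pose v : 'cV[R[i]]_N := \col_k a k.+1.
have -> : a i.+1 = (invmx V *m (V *m v)) i 0 by rewrite mulKmx // mxE.
rewrite mxE mulr_suml; apply: le_trans (normc_sum _ _ _) _.
apply: ler_sum => j _; rewrite normcM ler_wpM2l ?normc_ge0 //.
suff -> : (V *m v) j 0 = dirichlet_poly N a (0 +i* (h *+ j)).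
  exact: le_sup_imag_axis.
rewrite mxE /dirichlet_poly big_add1 big_mkord; apply: eq_bigr => k _.
rewrite !mxE mulrC -cexpMn dirichlet_arg; congr (_ * cexp _).
have mulIn (m : nat) (y : R) : (0 +i* y) *+ m = 0 +i* (y *+ m) :> R[i].
  elim: m => [|m IH]; first by rewrite !mulr0n.
  rewrite !mulrS IH; apply/eqP.
  by rewrite eq_complex /= addr0 !eqxx.
by rewrite mulIn mulNrn mulrnAl.
Qed.

Lemma sidon_least N : (0 < N)%N ->
  sidon_bounds R N (sidon R N) /\ lbound (sidon_bounds R N) (sidon R N).
Proof.
move=> N0; split; last first.
  by apply: ge_inf; exists 0; exact: sidon_bounds_ge0.
move=> a; have := sup_imag_axis_ge0 N a.
rewrite le_eqVlt => /orP[/eqP s0|s0]; last first.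
  rewrite -ler_pdivrMr //; apply: lb_le_inf; first exact: sidon_bounds_nonempty.
  by move=> C hC; rewrite ler_pdivrMr //; exact: hC.
by have [C /(_ a)] := sidon_bounds_nonempty N0; rewrite -s0 !mulr0.
Qed.

End SidonLeast.

(* Main.v *)
Require Import Defs.
From mathcomp Require Import all_boot all_order all_algebra.
From mathcomp Require Import all_classical all_reals all_analysis.
From mathcomp Require Import complex ring lra zify.

(** Write [x = log N], [l = log x] and [L = sqrt (x l)].

    Upper bound.  By unique factorization (Kronecker, Bohr) the supremum over
    [t] bounds [|sum a_n e^(i g(n))|] for every real completely additive [g].
    Twisting by [g] isolates the terms having a prescribed number of factors
    [p] for each prime [p < 17] and a prescribed number [d] of prime factors
    [>= 17].  Sorting such a piece [Q] by the exponents of a set of primes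
    shows that [sum_p |D_p Q| <= 4 m^2 sup |Q|] at every point of the
    polytorus, where [D_p Q = sum v_p(n) a_n n^(-s)] and [m = O(log N)].  As
    [D_p Q] has few representations [n n' = k], its fourth moment is at most
    [4^d] times the square of its second moment, so its mean is comparable to
    its mean square up to a factor [O(2^d)].  Grouping [n] by its largest
    prime factor [p], Cauchy-Schwarz leads to the square root of the sum of
    [4^d] over the [n <= N] with largest prime factor [p], which Rankin's
    method bounds by [N exp (-(Y + L^2 / (2 Y)) + o(L))], [Y = log p]; and
    [Y + L^2 / (2 Y) >= sqrt 2 L].

    Lower bound.  For [y = exp (L / sqrt 2)] take random signs on the
    [y]-smooth integers up to [N]: their polynomial depends on fewer than [y]
    numbers [p^(-it)], so its supremum is at most [sqrt (Psi(N, y) y)] up to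
    factors [exp (o(L))], while [Psi(N, y) >= N exp (-(1 / sqrt 2 + o(1)) L)]
    by iterating [Psi(X) log X >= sum_(p <= y) Psi(X / p) log p]. *)

Set Implicit Arguments.
Unset Strict Implicit.
Unset Printing Implicit Defensive.

Import Order.TTheory GRing.Theory Num.Theory.
Import numFieldNormedType.Exports.
Import Normc.

Local Open Scope classical_set_scope.
Local Open Scope ring_scope.

(** * Exponential sums and their means *)

Section UnitCircle.
Local Open Scope complex_scope.
Local Notation Re := complex.Re.
Local Notation Im := complex.Im.
Variable R : realType.
Implicit Types (x y t : R) (z w : R[i]).

(** No measure on the polytorus is constructed: means are Cesaro averages over integer samples,
    computed up to an error that does not depend on the number of samples. Kronecker's theorem is
    not proved as a density statement either; the bound it would give follows from Parseval for the
    k-th powers of the sum, since the loss is only polynomial in k. The main obstacle is to get from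
    pointwise bounds back to the coefficients. Comparing first and second moments costs a factor of
    order 2^d, unbounded in d. Once d is fixed, this loss can be charged to the integers themselves
    as the weight 4^d, and Rankin's method tolerates that weight on all primes but the smallest,
    whose exponents are therefore prescribed. The number of pieces is a power of log N, hence
    negligible. In the lower bound the ratio of the sum of the |a_n| to the supremum is about sqrt
    (Psi(N, y) / y). For log y = c L, Psi(N, y) / y is about N exp (-(c + 1 / (2 c)) L), which is
    largest at c = 1 / sqrt 2: the same balance as that of Y + L^2 / (2 Y) in the upper bound. *)

Definition cis x : R[i] := cexp (0 +i* x).

Lemma cisE x : cis x = cos x +i* sin x.
Proof. by rewrite /cis /cexp expR0 !mul1r. Qed.

Lemma cis0 : cis 0 = 1.
Proof. by rewrite cisE cos0 sin0. Qed.

Lemma cisD x y : cis (x + y) = cis x * cis y.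
Proof.
by rewrite /cis -cexpD; congr cexp; apply/eqP; rewrite eq_complex /= addr0 !eqxx.
Qed.

Lemma cisMn x n : cis (x *+ n) = cis x ^+ n.
Proof. by elim: n => [|n IH]; rewrite ?cis0 // mulrS cisD IH exprS. Qed.

Lemma normc_cis x : normc (cis x) = 1.
Proof. exact: normc_cexp_im. Qed.

Lemma conjc_cis x : conjc (cis x) = cis (- x).
Proof. by rewrite !cisE cosN sinN. Qed.

Lemma cis_eq1 x : `|x| <= 1 -> cis x = 1 -> x = 0.
Proof.
rewrite cisE => x1 [+ _]; rewrite -cos_norm -[1 in RHS]cos0 => /cos_inj xE.
apply/eqP; rewrite -normr_eq0; apply/eqP; apply: xE.
  by rewrite in_itv /= normr_ge0 (le_trans x1) // (le_trans _ (pi_ge2 R)) // ler1n.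
by rewrite in_itv /= lexx pi_ge0.
Qed.

Lemma conjcM z w : conjc (z * w) = conjc z * conjc w.
Proof. exact: rmorphM. Qed.

Lemma sqr_normc z : (normc z) ^+ 2 = Re (z * conjc z).
Proof.
case: z => a b; rewrite /normc sqr_sqrtr ?addr_ge0 ?sqr_ge0 //= mulrN opprK.
by rewrite !expr2.
Qed.

Lemma normcX z n : normc (z ^+ n) = normc z ^+ n.
Proof.
elim: n => [|n IH]; first by rewrite !expr0 (normc1 R).
by rewrite !exprS normcM IH.
Qed.

Lemma normcMnat z n : normc (z *+ n) = normc z *+ n.
Proof. exact: normcMn. Qed.

Lemma normc_real x : normc (x%:C) = `|x|.
Proof. by rewrite /normc /= expr0n /= addr0 sqrtr_sqr. Qed.

Lemma normcB_sym z w : normc (z - w) = normc (w - z).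
Proof. by rewrite -(normcN (z - w)) opprB. Qed.

Lemma ler_norm_Re z : `|Re z| <= normc z.
Proof. by case: z => a b; rewrite /normc /= -sqrtr_sqr ler_wsqrtr // lerDl sqr_ge0. Qed.

Lemma ler_norm_Im z : `|Im z| <= normc z.
Proof. by case: z => a b; rewrite /normc /= -sqrtr_sqr ler_wsqrtr // lerDr sqr_ge0. Qed.

Lemma ler_normc_ReIm z : normc z <= `|Re z| + `|Im z|.
Proof.
case: z => a b; rewrite /normc /= -[leRHS]ger0_norm ?addr_ge0 // -sqrtr_sqr.
rewrite ler_wsqrtr // sqrrD !real_normK ?num_real // lerD2r lerDl.
by rewrite mulrn_wge0 // mulr_ge0.
Qed.

Lemma Re_sum (I : Type) (r : seq I) (P : pred I) (F : I -> R[i]) :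
  Re (\sum_(i <- r | P i) F i) = \sum_(i <- r | P i) Re (F i).
Proof.
elim: r => [|i r IH]; rewrite ?big_nil // !big_cons; case: (P i) => //.
by rewrite -IH; case: (F i) (\sum_(_ <- _ | _) _) => [a b] [c d].
Qed.

Lemma Im_sum (I : Type) (r : seq I) (P : pred I) (F : I -> R[i]) :
  Im (\sum_(i <- r | P i) F i) = \sum_(i <- r | P i) Im (F i).
Proof.
elim: r => [|i r IH]; rewrite ?big_nil // !big_cons; case: (P i) => //.
by rewrite -IH; case: (F i) (\sum_(_ <- _ | _) _) => [a b] [c d].
Qed.

Lemma ReMn z n : Re (z *+ n) = Re z *+ n.
Proof.
elim: n => [|n IH]; first by rewrite !mulr0n.
by rewrite !mulrS -IH; case: z (z *+ n) {IH} => [a b] [c d].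
Qed.

Lemma ReB z w : Re (z - w) = Re z - Re w.
Proof. by case: z w => [a b] [c d]. Qed.

Lemma cis_geometric_bound x : `|x| <= 1 -> x != 0 ->
  exists2 C : R, 0 <= C & forall T, normc (\sum_(s < T) cis (x *+ s)) <= C.
Proof.
move=> x1 x0; pose w := 1 - cis x.
have w0 : 0 < normc w.
  rewrite lt_neqAle normc_ge0 andbT eq_sym; apply: contra_neqN x0 => /eqP /eq0_normc.
  by move/eqP; rewrite subr_eq0 eq_sym => /eqP /(cis_eq1 x1).
exists (2 / normc w) => [|T]; first by rewrite divr_ge0 ?(ltW w0).
rewrite ler_pdivlMr // -normcM mulrC.
have -> : w * \sum_(s < T) cis (x *+ s) = 1 - cis (x *+ T).
  rewrite /w cisMn -[RHS]opprB subrX1 -[LHS]opprK -mulNr opprB; congr (- (_ * _)).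
  by apply: eq_bigr => s _; rewrite cisMn.
apply: le_trans (le_normcD _ _) _.
by rewrite normcN normc_cis (normc1 R).
Qed.

(** Each nonzero frequency contributes a bounded geometric sum, because [|th j| <= 1] keeps it away
    from the nonzero multiples of 2 pi. Only frequency zero grows with [T]. *)
Lemma cesaro_cis (I : finType) (c : I -> R[i]) (th : I -> R) :
    (forall j, `|th j| <= 1) ->
  exists C : R, forall T,
    normc (\sum_(s < T) \sum_j c j * cis (th j *+ s)
           - (\sum_(j | th j == 0) c j) *+ T) <= C.
Proof.
move=> th1.
have bnd j : exists C : R, forall T,
    normc (\sum_(s < T) c j * cis (th j *+ s) - (if th j == 0 then c j else 0) *+ T) <= C.
  have [th0|th0] := eqVneq (th j) 0.
    exists 0 => T; rewrite (eq_bigr (fun=> c j)) => [|s _]; last first.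
      by rewrite th0 mul0rn cis0 mulr1.
    by rewrite big_const_ord iter_addr_0 subrr normc0.
  have [C C0 HC] := cis_geometric_bound (th1 j) th0.
  exists (normc (c j) * C) => T.
  rewrite mul0rn subr0 -mulr_sumr normcM ler_wpM2l ?normc_ge0 //.
exists (\sum_j sval (cid (bnd j))) => T.
rewrite exchange_big (big_mkcond (fun j => th j == 0)) -sumrMnl -sumrB.
apply: le_trans (normc_sum _ _ _) _; apply: ler_sum => j _.
by case: (cid (bnd j)) => C /= /(_ T).
Qed.

(** Parseval's identity up to a bounded error. Expanding the square produces the frequencies
    [g i - g j]; the bound 1 on them rules out aliasing modulo 2 pi. *)
Lemma mean_square_cis (I : finType) (c : I -> R[i]) (g : I -> R) :
    (forall i j, `|g i - g j| <= 1) -> injective g ->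
  exists C : R, forall T,
    `|\sum_(s < T) normc (\sum_i c i * cis (g i *+ s)) ^+ 2
      - (\sum_i normc (c i) ^+ 2) *+ T| <= C.
Proof.
move=> g1 g_inj.
have [C HC] := @cesaro_cis (I * I)%type (fun p => c p.1 * conjc (c p.2))
  (fun p => g p.1 - g p.2) (fun p => g1 p.1 p.2).
exists C => T; apply: le_trans (HC T); apply: le_trans (ler_norm_Re _).
rewrite le_eqVlt; apply/orP; left; apply/eqP; congr `|_|.
rewrite ReB ReMn !Re_sum; congr (_ - _ *+ T).
  apply: eq_bigr => s _; rewrite sqr_normc rmorph_sum /= mulr_suml !Re_sum.
  rewrite -(pair_bigA _ (fun i j => Re (c i * conjc (c j) * cis ((g i - g j) *+ s)))) /=.
  apply: eq_bigr => i _; rewrite mulr_sumr Re_sum; apply: eq_bigr => j _; congr Re.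
  by rewrite conjcM conjc_cis mulrnBl cisD; ring.
rewrite (eq_bigl (fun p : I * I => p.1 == p.2)) => [|[i j] /=]; last first.
  by rewrite subr_eq0; apply/eqP/eqP => [/g_inj|->].
rewrite -(pair_big_dep xpredT (fun i j => i == j) (fun i j => Re (c i * conjc (c j)))) /=.
apply: eq_bigr => i _; rewrite (big_pred1 i) ?sqr_normc // => j.
Qed.

End UnitCircle.

(** * Completely additive functions *)

Section CompletelyAdditive.

Definition cadd (V : nmodType) (g : nat -> V) :=
  forall m n, (0 < m)%N -> (0 < n)%N -> g (m * n)%N = g m + g n.

(** As [logn q n] is 0 for composite [q], this is the completely additive function with the value
    [w q] at each prime [q]. *)
Definition padd (V : nmodType) (w : nat -> V) (n : nat) : V :=
  \sum_(q < n.+1) w q *+ logn q n.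

Lemma logn_leq n q : logn q n != 0%N -> (q <= n)%N && prime q.
Proof. by rewrite -lt0n logn_gt0 mem_primes => /and3P[-> n0 /(dvdn_leq n0) ->]. Qed.

Lemma padd_widen (V : nmodType) (w : nat -> V) n B : (n <= B)%N ->
  padd w n = \sum_(q < B.+1) w q *+ logn q n.
Proof.
move=> nB; rewrite /padd.
rewrite (big_ord_widen B.+1 (fun q => w q *+ logn q n)) //.
rewrite big_mkcond; apply: eq_bigr => q _; case: ifP => // /negbT.
rewrite ltnS => qn; have [->|/logn_leq] := eqVneq (logn q n) 0%N; first by rewrite mulr0n.
by rewrite (negbTE qn).
Qed.

Lemma cadd_padd (V : nmodType) (w : nat -> V) : cadd (padd w).
Proof.
move=> m n m0 n0.
rewrite (@padd_widen _ _ m (m * n)%N) ?leq_pmulr //.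
rewrite (@padd_widen _ _ n (m * n)%N) ?leq_pmull // -big_split.
by apply: eq_bigr => q _; rewrite lognM // mulrnDr.
Qed.

Lemma padd_prime (V : nmodType) (w : nat -> V) q : prime q -> padd w q = w q.
Proof.
move=> pq; rewrite /padd (bigD1 (inord q)) //= inordK // big1 => [|i iq].
  by rewrite addr0 logn_prime // eqxx mulr1n.
rewrite logn_prime // (_ : (_ == _) = false) ?mulr0n //.
by apply: contraNF iq => /eqP iq; apply/eqP/val_inj; rewrite /= inordK.
Qed.

Lemma cadd1 (V : zmodType) (g : nat -> V) : cadd g -> g 1%N = 0.
Proof.
by move=> gD; apply: (addrI (g 1%N)); rewrite -gD // mul1n addr0.
Qed.

Lemma cadd_ind (P : nat -> Prop) : P 1%N ->
  (forall q n, prime q -> (0 < n)%N -> P n -> P (q * n)%N) ->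
  forall n, (0 < n)%N -> P n.
Proof.
move=> P1 Pq n; elim/ltn_ind: n => n IH n0.
have [->//|n1] := eqVneq n 1%N.
have ngt1 : (1 < n)%N by rewrite ltn_neqAle eq_sym n1.
have pn := pdiv_prime ngt1; have dn := pdiv_dvd n.
rewrite -(divnK dn) mulnC; apply: Pq => //; first by rewrite divn_gt0 ?pdiv_gt0 // dvdn_leq.
by apply: IH; [rewrite ltn_Pdiv // prime_gt1|rewrite divn_gt0 ?pdiv_gt0 // dvdn_leq].
Qed.

Lemma cadd_eq (V : zmodType) (g h : nat -> V) : cadd g -> cadd h ->
  (forall q, prime q -> g q = h q) -> forall n, (0 < n)%N -> g n = h n.
Proof.
move=> gD hD gh; apply: cadd_ind => [|q n pq n0 IH]; first by rewrite !cadd1.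
have q0 := prime_gt0 pq; have -> := gD _ _ q0 n0; have -> := hD _ _ q0 n0.
by rewrite gh // IH.
Qed.

Lemma cadd_eq_padd (V : zmodType) (g : nat -> V) : cadd g ->
  forall n, (0 < n)%N -> g n = padd g n.
Proof.
move=> gD; apply: cadd_eq => //; first exact: cadd_padd.
by move=> q pq; rewrite padd_prime.
Qed.

Lemma cadd_natr_padd (R : pzSemiRingType) (w : nat -> nat) :
  cadd (fun n => (padd w n)%:R : R).
Proof. by move=> m n m0 n0; rewrite cadd_padd // natrD. Qed.

Definition Omega := padd (fun=> 1%N).

Lemma OmegaM m n : (0 < m)%N -> (0 < n)%N -> Omega (m * n) = (Omega m + Omega n)%N.
Proof. exact: cadd_padd. Qed.

Lemma Omega1 : Omega 1 = 0%N.
Proof. by apply: (@addnI (Omega 1)); rewrite -OmegaM // mul1n addn0. Qed.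

Lemma expn_Omega n : (0 < n)%N -> (2 ^ Omega n <= n)%N.
Proof.
move: n; apply: cadd_ind => [|q n pq n0 IH]; first by rewrite Omega1.
have q0 := prime_gt0 pq; rewrite (OmegaM q0 n0) expnD leq_mul //.
by rewrite /Omega padd_prime // prime_gt1.
Qed.

Lemma leq_padd (w w' : nat -> nat) n : (forall q, w q <= w' q)%N ->
  (padd w n <= padd w' n)%N.
Proof.
move=> ww; apply: leq_sum => q _.
by elim: (logn q n) => // k IH; rewrite !mulrS leq_add.
Qed.

Lemma size_divisors_prime q n : prime q -> (0 < n)%N ->
  (size (divisors (q * n)) <= 2 * size (divisors n))%N.
Proof.
move=> pq n0; have q0 := prime_gt0 pq.
have -> : (2 * size (divisors n) = size (divisors n ++ map (muln q) (divisors n)))%N.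
  by rewrite size_cat size_map mul2n addnn.
apply: uniq_leq_size; first exact: divisors_uniq.
move=> d; rewrite mem_cat -!dvdn_divisors ?muln_gt0 ?q0 // => dqn.
have [qd|qd] := boolP (q %| d)%N.
  apply/orP; right; apply/mapP; exists (d %/ q)%N; last by rewrite mulnC divnK.
  by rewrite -dvdn_divisors // -(dvdn_pmul2l q0) mulnC divnK.
by apply/orP; left; rewrite -(@Gauss_dvdr d q) // coprime_sym prime_coprime.
Qed.

Lemma size_divisors_Omega n : (0 < n)%N -> (size (divisors n) <= 2 ^ Omega n)%N.
Proof.
move: n; apply: cadd_ind => [|q n pq n0 IH]; first by rewrite Omega1.
rewrite (OmegaM (prime_gt0 pq) n0) expnD {1}/Omega padd_prime // expn1.
by apply: leq_trans (size_divisors_prime pq n0) _; rewrite leq_mul2l IH orbT.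
Qed.

Lemma cadd_ln (R : realType) : cadd (fun n => ln n%:R : R).
Proof. by move=> m n m0 n0; rewrite natrM lnM // posrE ltr0n. Qed.

End CompletelyAdditive.

(** * Finite sums and Rankin's bound *)

Section FiniteSums.
Variable R : realType.

Lemma cauchy_schwarz_sum (I : Type) (r : seq I) (P : pred I) (x y : I -> R) :
  (\sum_(i <- r | P i) x i * y i) ^+ 2
    <= (\sum_(i <- r | P i) x i ^+ 2) * (\sum_(i <- r | P i) y i ^+ 2).
Proof.
elim: r => [|i r IH]; first by rewrite !big_nil expr0n /= mulr0.
rewrite !big_cons; case: (P i) => //.
set A := \sum_(_ <- _ | _) _ in IH *; set B := \sum_(_ <- _ | _) _ in IH *.
set C := \sum_(_ <- _ | _) _ in IH *.
have B0 : 0 <= B by apply: sumr_ge0 => j _; rewrite sqr_ge0.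
have C0 : 0 <= C by apply: sumr_ge0 => j _; rewrite sqr_ge0.
have AE : A <= Num.sqrt B * Num.sqrt C.
  by rewrite -sqrtrM // (le_trans (ler_norm _)) // -sqrtr_sqr ler_wsqrtr.
set u := x i; set v := y i; set b := Num.sqrt B in AE; set c := Num.sqrt C in AE.
have bE : B = b ^+ 2 by rewrite sqr_sqrtr.
have cE : C = c ^+ 2 by rewrite sqr_sqrtr.
have AE' : `|A| <= b * c by rewrite -sqrtrM // -sqrtr_sqr ler_wsqrtr.
have key : 2 * (u * v) * A <= (u * c) ^+ 2 + (v * b) ^+ 2.
  apply: le_trans (ler_norm _) _; rewrite normrM.
  apply: (@le_trans _ _ (`|2 * (u * v)| * (b * c))); first exact: ler_wpM2l.
  rewrite !normrM [`|2|]ger0_norm //.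
  rewrite -(real_normK (num_real (u * c))) -(real_normK (num_real (v * b))).
  rewrite !normrM (ger0_norm (sqrtr_ge0 B)) (ger0_norm (sqrtr_ge0 C)) -subr_ge0.
  have := sqr_ge0 (`|u| * c - `|v| * b); congr (0 <= _); rewrite -/b -/c; ring.
rewrite bE cE in IH *; nra.
Qed.

Lemma sum_sqr_card (I : finType) (P : pred I) (x : I -> R) :
  (\sum_(i | P i) x i) ^+ 2 <= #|P|%:R * \sum_(i | P i) x i ^+ 2.
Proof.
have := cauchy_schwarz_sum (index_enum I) P (fun=> 1) x.
by under eq_bigr do rewrite mul1r; rewrite expr1n sumr_const.
Qed.

Lemma sum_multiples (V : nmodType) q X (F : nat -> V) : (0 < q)%N ->
  \sum_(1 <= n < X.+1 | (q %| n)%N) F n = \sum_(1 <= r < (X %/ q).+1) F (q * r)%N.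
Proof.
move=> q0; elim: X => [|X IH]; first by rewrite div0n !big_geq.
rewrite big_mkcond big_nat_recr //= -big_mkcond IH divnS //.
case: ifP => [/dvdnP [k kE]|_]; last by rewrite addr0 add0n.
rewrite add1n [RHS]big_nat_recr //=; congr (_ + F _).
have := divnS X q0; rewrite kE dvdn_mull // mulnK // add1n => <-.
by rewrite mulnC.
Qed.

Definition cmult (h : nat -> R) := forall m n, (0 < m)%N -> (0 < n)%N ->
  h (m * n)%N = h m * h n.

(** The allowed primes form a list rather than an initial segment, so that Rankin's bound can be
    proved by removing one prime at a time. *)
Definition smooth (s : seq nat) n := all [in s] (primes n).

Definition primes_upto N := [seq q <- iota 0 N.+1 | prime q].

Lemma mem_primes_upto N q : (q \in primes_upto N) = prime q && (q <= N)%N.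
Proof. by rewrite mem_filter mem_iota. Qed.

Lemma smoothM s m n : (0 < m)%N -> (0 < n)%N ->
  smooth s (m * n) = smooth s m && smooth s n.
Proof.
move=> m0 n0; apply/allP/andP => [h|[/allP hm /allP hn] p].
  by split; apply/allP => p hp; apply: h; rewrite primesM // hp ?orbT.
by rewrite primesM // => /orP[/hm|/hn].
Qed.

Lemma smooth_le s X : (forall q, prime q -> (q <= X)%N -> q \in s) ->
  forall n, (n <= X)%N -> smooth s n.
Proof.
move=> hs n nX; apply/allP => q; rewrite mem_primes => /and3P[pq n0 qn].
by apply: hs => //; apply: leq_trans nX; apply: dvdn_leq.
Qed.

(* Splitting off the multiples of the first prime q of s gives Z' <= Z + h(q) Z'
   for the sums Z' over s and Z over the remaining primes. *)
Lemma rankin (s : seq nat) (h : nat -> R) X : cmult h -> h 1%N = 1 ->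
    (forall n, (0 < n)%N -> 0 <= h n) ->
    (forall q, q \in s -> prime q /\ h q < 1) ->
  \sum_(1 <= n < X.+1 | smooth s n) h n <= \prod_(q <- s) (1 - h q)^-1.
Proof.
move=> hM h1 h0; elim: s => [|q s IH] hs.
  rewrite big_nil; apply: (@le_trans _ _ (\sum_(1 <= n < X.+1 | n == 1%N) h n)).
    rewrite le_eqVlt; apply/orP; left; apply/eqP.
    rewrite [LHS]big_nat_cond [RHS]big_nat_cond; apply: eq_bigl => n.
    case: (boolP (0 < n < X.+1)%N) => //= /andP[n1 _]; rewrite /smooth.
    have [->//|n1'] := eqVneq n 1%N.
    have ngt1 : (1 < n)%N by rewrite ltn_neqAle eq_sym n1'.
    by apply/negbTE/allPn; exists (pdiv n); rewrite ?mem_primes ?pdiv_prime ?n1 ?pdiv_dvd.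
  case: X => [|X]; first by rewrite big_geq ?ler01.
  rewrite big_mkcond big_ltn //= h1 -big_mkcond big_nat_cond big1 ?addr0 //.
  by move=> n /andP[/andP[]]; case: n => [|[]].
have [pq hq] := hs q (mem_head _ _); have q0 := prime_gt0 pq.
have {}IH := IH (fun p ps => hs p (mem_behead (s := q :: s) ps)).
rewrite big_cons mulrC ler_pdivlMr ?subr_gt0 //; apply: le_trans IH.
rewrite mulrBr mulr1 lerBlDr.
set Z := \sum_(1 <= n < X.+1 | smooth (q :: s) n) h n.
rewrite {1}/Z (bigID (fun n => q %| n)%N) /= addrC; apply: lerD.
  rewrite big_mkcond [leRHS]big_mkcond; apply: ler_sum_nat => n /andP[n0 _].
  case: ifP => [/andP[/allP sn qn]|_]; last by case: ifP => // _; exact: h0.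
  rewrite ifT //; apply/allP => p pn; have := sn p pn; rewrite /= inE => /orP[/eqP pE|//].
  by move: pn; rewrite mem_primes pE (negbTE qn) !andbF.
rewrite big_mkcondl /= sum_multiples // big_nat_cond.
rewrite (eq_bigr (fun r => if smooth (q :: s) r then h r * h q else 0)); last first.
  move=> r /andP[/andP[r0 _] _]; rewrite smoothM // hM // mulrC.
  by rewrite [smooth _ q]/smooth primes_prime //= mem_head.
rewrite -big_nat_cond -big_mkcond -mulr_suml ler_wpM2r ?h0 //.
rewrite /Z (@big_cat_nat _ _ _ (X %/ q).+1 1 X.+1) //= ?ltnS ?leq_div //.
rewrite lerDl big_nat_cond; apply: sumr_ge0 => n /andP[/andP[n1 _] _].
by apply: h0; apply: leq_trans n1.
Qed.

End FiniteSums.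

(** * Dirichlet polynomials *)

Section DirichletSums.
Local Open Scope complex_scope.
Variable R : realType.
Implicit Types (a b c : nat -> R[i]) (g : nat -> R).

(** A completely additive [g] is arbitrary on the primes, so these [g] parametrize the points of the
    polytorus. The choice [g = vert t] gives the terms a_n n^(-it). *)
Definition dsum N a g : R[i] := \sum_(1 <= n < N.+1) a n * cis (g n).

Definition vert (t : R) n : R := - (t * ln n%:R).

Lemma dsum_ord N a g : dsum N a g = \sum_(i < N) a i.+1 * cis (g i.+1).
Proof. by rewrite /dsum big_add1 big_mkord. Qed.

Lemma sum_nat_ord (V : nmodType) N (F : nat -> V) :
  \sum_(1 <= n < N.+1) F n = \sum_(i < N) F i.+1.
Proof. by rewrite big_add1 big_mkord. Qed.

Lemma dirichlet_polyE N a t : dirichlet_poly N a (0 +i* t) = dsum N a (vert t).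
Proof.
by rewrite /dirichlet_poly; apply: eq_bigr => n _; rewrite dirichlet_arg.
Qed.

Lemma cadd_vert t : cadd (vert t).
Proof. by move=> m n m0 n0; rewrite /vert cadd_ln // mulrDr opprD. Qed.

Lemma le_dsum_sup N a t : normc (dsum N a (vert t)) <= sup_imag_axis N a.
Proof. by rewrite -dirichlet_polyE; exact: le_sup_imag_axis. Qed.

Lemma normc_dsum_le N a g : normc (dsum N a g) <= \sum_(1 <= n < N.+1) normc (a n).
Proof.
apply: le_trans (normc_sum _ _ _) _; apply: ler_sum => n _.
by rewrite normcM normc_cis mulr1.
Qed.

(** Sampling at the multiples of 1 / B' puts all frequencies ln n / B' into [0, 1], where they stay
    distinct. Allowing B' > B lets a polynomial and its square be sampled at the same points. *)
Lemma mean_square_vert B B' c : (B <= B')%N -> exists C : R, forall T,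
  `|\sum_(s < T) normc (dsum B c (vert (s%:R / B'%:R))) ^+ 2
    - (\sum_(1 <= n < B.+1) normc (c n) ^+ 2) *+ T| <= C.
Proof.
move=> BB'; pose h : R := B'%:R^-1; pose g (i : 'I_B) : R := - (h * ln i.+1%:R).
have i0 (i : 'I_B) : 0 < i.+1%:R :> R by rewrite ltr0n.
have g1 i j : `|g i - g j| <= 1.
  have bnd (k : 'I_B) : 0 <= h * ln k.+1%:R <= 1.
    rewrite mulr_ge0 ?invr_ge0 ?ler0n ?ln_ge0 ?ler1n //=.
    have B'0 : (0 < B')%N by apply: leq_trans BB'; apply: leq_ltn_trans (ltn_ord k).
    rewrite mulrC ler_pdivrMr ?ltr0n // mul1r.
    apply: le_trans (ltW (ln_sublinear (i0 k))) _; rewrite ler_nat.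
    by apply: leq_trans BB'.
  rewrite /g; have := bnd i; have := bnd j.
  move: (h * _) (h * _) => u v /andP[? ?] /andP[? ?]; rewrite ler_norml; lra.
have g_inj : injective g.
  move=> i j /oppr_inj; have h0 : h != 0.
    rewrite invr_eq0 pnatr_eq0 -lt0n; apply: leq_trans BB'.
    exact: leq_ltn_trans (ltn_ord i).
  move/(mulfI h0)/ln_inj; rewrite !posrE => /(_ (i0 i) (i0 j)) /eqP.
  by rewrite eqr_nat eqSS => /eqP /val_inj.
have [C HC] := mean_square_cis (fun i : 'I_B => c i.+1) g1 g_inj.
exists C => T; apply: le_trans (HC T); rewrite sum_nat_ord le_eqVlt; apply/orP; left.
apply/eqP; congr (`| _ - _ |); apply: eq_bigr => s _; rewrite dsum_ord.
congr (normc _ ^+ 2); apply: eq_bigr => i _; congr (_ * cis _).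
by rewrite /vert /g mulNrn -[(h * _) *+ s]mulr_natl mulrA.
Qed.

(** Dividing by [T] removes the bounded error: this is how estimates of Cesaro sums become
    inequalities between means. *)
Lemma le_of_natmul (u v C : R) : (forall T : nat, u *+ T <= v *+ T + C) -> u <= v.
Proof.
move=> H; rewrite leNgt; apply/negP => vu; have d0 : 0 < u - v by rewrite subr_gt0.
have := H (Num.truncn (C / (u - v))).+1; apply/negP; rewrite -ltNge.
rewrite -ltrBrDl -mulrnBl -mulr_natr mulrC -ltr_pdivrMr //.
exact: truncnS_gt.
Qed.

Lemma mean_square_le_sup B c (M : R) :
    (forall t, normc (dsum B c (vert t)) <= M) ->
  \sum_(1 <= n < B.+1) normc (c n) ^+ 2 <= M ^+ 2.
Proof.
move=> HM; have [C HC] := mean_square_vert c (leqnn B).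
apply: (@le_of_natmul _ _ C) => T; have := HC T.
have : \sum_(s < T) normc (dsum B c (vert (s%:R / B%:R))) ^+ 2 <= M ^+ 2 *+ T.
  rewrite -[T in leRHS]card_ord -sumr_const; apply: ler_sum => s _.
  by rewrite lerXn2r ?nnegrE ?normc_ge0 // (le_trans (normc_ge0 _) (HM 0)).
move: (\sum_(_ < T) _) ((\sum_(_ <= _ < _) _) *+ T) (M ^+ 2 *+ T) => x y z.
by rewrite ler_norml; lra.
Qed.

Definition conv A B a b l : R[i] :=
  \sum_(p : 'I_A * 'I_B | (p.1.+1 * p.2.+1 == l)%N) a p.1.+1 * b p.2.+1.

Lemma sum_by_product A B (V : nmodType) (F : 'I_A * 'I_B -> V) :
  \sum_p F p = \sum_(1 <= l < (A * B).+1)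
     \sum_(p : 'I_A * 'I_B | (p.1.+1 * p.2.+1 == l)%N) F p.
Proof.
rewrite sum_nat_ord.
(* The product is shifted down by one. [(A * B).-1.+1] is a nonempty ordinal bound, as [inord]
   requires; it differs from [A * B] only when that is 0, which is treated apart. *)
rewrite (partition_big (fun p : 'I_A * 'I_B => inord (p.1.+1 * p.2.+1).-1 : 'I_(A * B).-1.+1)
   xpredT) //=.
have [AB0|AB0] := posnP (A * B)%N.
  rewrite AB0 big_ord0 big1 // => l _; apply: big1 => -[i j].
  have := leq_mul (ltn_ord i) (ltn_ord j); rewrite AB0 leqn0 muln_eq0.
  by [].
rewrite (eq_bigr (fun l : 'I_(A * B).-1.+1 =>
   \sum_(p : 'I_A * 'I_B | (p.1.+1 * p.2.+1 == l.+1)%N) F p)); last first.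
  move=> l _; apply: eq_bigl => -[i j] /=.
  have ijAB : (i.+1 * j.+1 <= A * B)%N := leq_mul (ltn_ord i) (ltn_ord j).
  have ij0 : (0 < i.+1 * j.+1)%N by rewrite muln_gt0.
  rewrite -val_eqE /= inordK; first by apply/eqP/eqP; lia.
  lia.
by rewrite -(big_mkord xpredT (fun l => \sum_(p : 'I_A * 'I_B |
   (p.1.+1 * p.2.+1 == l.+1)%N) F p)) prednK // big_mkord.
Qed.

Lemma dsumM A B a b g : cadd g ->
  dsum A a g * dsum B b g = dsum (A * B) (conv A B a b) g.
Proof.
move=> gD; rewrite (dsum_ord A) (dsum_ord B) mulr_suml.
under eq_bigr do rewrite mulr_sumr.
rewrite pair_big /= sum_by_product /dsum; apply: eq_bigr => l _.
rewrite /conv mulr_suml; apply: eq_bigr => -[i j] /= /eqP <-.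
by rewrite gD // cisD; ring.
Qed.

Lemma conv_neq0 A B a b l : conv A B a b l != 0 -> exists n m,
  [/\ (0 < n <= A)%N, (0 < m <= B)%N, (n * m)%N = l, a n != 0 & b m != 0].
Proof.
move=> cl; have [p /andP[/eqP pl ab]] : exists p : 'I_A * 'I_B,
    (p.1.+1 * p.2.+1 == l)%N && (a p.1.+1 * b p.2.+1 != 0).
  apply/existsP; apply: contra_neqT cl => /existsPn H; apply: big1 => p pl.
  by have := H p; rewrite pl /= negbK => /eqP.
exists p.1.+1, p.2.+1; split=> //.
- by rewrite ltn_ord.
- by rewrite ltn_ord.
- by apply: contraNneq ab => ->; rewrite mul0r.
- by apply: contraNneq ab => ->; rewrite mulr0.
Qed.

(** What matters about the support is that it has few elements: no prime factor exceeds N, and the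
    number of prime factors is linear in k. The crude bound [Omega n <= N] suffices since N is fixed
    while k grows. *)
Lemma dsumX N a k : exists c,
  (forall g, cadd g -> dsum N a g ^+ k = dsum (N ^ k) c g) /\
  (forall l, c l != 0 -> [/\ (0 < l)%N, smooth (primes_upto N) l
                          & (Omega l <= k * N)%N]).
Proof.
elim: k => [|k [c [cE c0]]].
  exists (fun n => if n == 1%N then 1 else 0); split=> [g gD|l].
    by rewrite expr0 expn0 /dsum big_nat1 (cadd1 gD) cis0 mulr1.
  have [->|] := eqVneq l 1%N; last by rewrite eqxx.
  by rewrite Omega1.
exists (conv N (N ^ k) a c); split=> [g gD|l /conv_neq0 [n [m]]].
  by rewrite exprS cE // dsumM // expnS.
case=> /andP[n0 nN] _ <- _ /c0 [m0 sm Om]; rewrite muln_gt0 n0 m0 smoothM // sm.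
have ON : (Omega n <= N)%N.
  apply: leq_trans nN; apply: leq_trans (expn_Omega n0); apply: ltnW.
  exact: ltn_expl.
rewrite OmegaM // mulSn leq_add //; split=> //.
by rewrite andbT; apply: (smooth_le _ nN) => q pq qN; rewrite mem_primes_upto pq.
Qed.

End DirichletSums.

(** * Kronecker's theorem *)

Section Kronecker.
Local Open Scope complex_scope.
Variable R : realType.
Implicit Types (a b c : nat -> R[i]) (g : nat -> R).

Lemma tensor_power_trick (T S A : R) (m : nat) : 0 <= T -> 0 <= S -> 0 < A ->
  (forall k, (0 < k)%N -> T ^+ k <= A * k.+1%:R ^+ m * S ^+ k) -> T <= S.
Proof.
move=> T0 S0 A0 H; rewrite leNgt; apply/negP => ST.
have Tp : 0 < T by apply: le_lt_trans ST.
have [SE|Sn0] := eqVneq S 0.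
  by have := H 1%N isT; rewrite SE !expr1 mulr0 leNgt Tp.
have Sp : 0 < S by rewrite lt_neqAle eq_sym Sn0.
pose r := T / S.
have lr : 0 < ln r by rewrite ln_gt0 // ltr_pdivlMr // mul1r.
have [j j0 jr] : exists2 j, (0 < j)%N & `|ln A| + 2 * m%:R < j%:R * ln r.
  exists (Num.truncn ((`|ln A| + 2 * m%:R) / ln r)).+1 => //.
  by rewrite -ltr_pdivrMr //; exact: truncnS_gt.
(* For this exponent k, k + 1 = (j + 1)^2, so ln (k + 1) <= 2 j. Then k ln r >= j^2 ln r exceeds ln
   A + 2 m j by the choice of j. *)
have k0 : (0 < j ^ 2 + 2 * j)%N by rewrite addn_gt0 expn_gt0 j0.
have r0 : 0 < r by rewrite divr_gt0.
have J0 : 0 < j.+1%:R :> R by rewrite ltr0n.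
have kE : (j ^ 2 + 2 * j).+1%:R = j.+1%:R ^+ 2 :> R.
  by rewrite -natrX -[j.+1]addn1 sqrnD exp1n muln1 addnAC addn1.
have := H _ k0; rewrite -ler_pdivrMr ?exprn_gt0 // -expr_div_n -/r kE -exprM.
rewrite -ler_ln ?posrE; [|by rewrite exprn_gt0|by rewrite mulr_gt0 ?exprn_gt0].
rewrite lnM ?posrE; [|by []|by rewrite exprn_gt0].
rewrite !lnXn //.
have lj : ln j.+1%:R <= j%:R :> R.
  by rewrite -addn1 natrD addrC le_ln1Dx // (lt_le_trans _ (ler0n _ _)) // ltrN10.
have j1 : 1 <= j%:R :> R by rewrite ler1n.
rewrite -[ln r *+ _]mulr_natr -[ln j.+1%:R *+ _]mulr_natr natrD natrX !natrM.
move: (normr_ge0 (ln A)) (ler_norm (ln A)) jr lj j1 lr.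
move: (ler0n R m); move: (m%:R) (j%:R) (ln j.+1%:R) (ln r) (ln A) `|ln A| => M J L r' lA nA.
move=> M0 nA_ge0 hA hJ hL J1 r'0; apply/negP; rewrite -ltNge.
have h1 : 2 * L * M <= 2 * J * M by rewrite ler_wpM2r // ler_wpM2l.
have h2 : (nA + 2 * M) * J < J * r' * J by rewrite ltr_pM2r //; apply: lt_le_trans J1; exact: ltr01.
have nA0 : nA <= nA * J by rewrite ler_peMr.
have h3 : 0 <= r' * J by rewrite mulr_ge0 ?(ltW r'0) // (le_trans ler01).
lra.
Qed.

Lemma cmult_expr (x : R) : cmult (fun n => x ^+ Omega n).
Proof. by move=> m n m0 n0; rewrite OmegaM // exprD. Qed.

(** Rankin's method in the variable [Omega], with weight rho^Omega and rho = k / (k + 1): removing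
    the weight costs rho^(-kN) <= e^N, and each of the at most N + 1 Euler factors equals k + 1. The
    bound is polynomial in k. *)
Lemma smooth_count N k X : (0 < k)%N ->
  \sum_(1 <= l < X.+1 | smooth (primes_upto N) l && (Omega l <= k * N)%N) (1 : R)
    <= expR N%:R * k.+1%:R ^+ N.+1.
Proof.
move=> k0; pose rho : R := k%:R / k.+1%:R.
have k1 : 0 < k.+1%:R :> R by rewrite ltr0n.
have kp : 0 < k%:R :> R by rewrite ltr0n.
have rho0 : 0 < rho by rewrite divr_gt0.
have rhoE : 1 - rho = k.+1%:R^-1.
  apply: (mulIf (lt0r_neq0 k1)); rewrite mulrBl mul1r divfK ?lt0r_neq0 //.
  by rewrite mulVf ?lt0r_neq0 // -natr1 addrAC subrr add0r.
have rho1 : rho < 1 by rewrite -subr_gt0 rhoE invr_gt0.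
have rhoN : rho ^- (k * N) <= expR N%:R.
  rewrite -exprVn exprM -[N%:R]mul1r expRM_natr. apply: lerXn2r; rewrite ?nnegrE ?exprn_ge0 ?invr_ge0 ?expR_ge0 ?(ltW rho0) //.
  rewrite -[X in expR X](mulVf (lt0r_neq0 kp)) expRM_natr; apply: lerXn2r; rewrite ?nnegrE ?invr_ge0 ?expR_ge0 ?(ltW rho0) //.
  apply: le_trans (expR_ge1Dx _); rewrite /rho invf_div -addn1 natrD mulrDl divff ?gt_eqF //.
  by rewrite mul1r.
apply: (@le_trans _ _ (rho ^- (k * N) *
    \sum_(1 <= l < X.+1 | smooth (primes_upto N) l) rho ^+ Omega l)).
  rewrite mulr_sumr big_mkcondr; apply: ler_sum => l _.
  have P0 : 0 <= rho ^- (k * N) * rho ^+ Omega l.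
    by rewrite mulr_ge0 ?invr_ge0 ?exprn_ge0 // ltW.
  case: ifP => // Ol; rewrite mulrC ler_pdivlMr ?exprn_gt0 // mul1r.
  by rewrite ler_wiXn2l // ltW.
apply: ler_pM => //; rewrite ?invr_ge0 ?exprn_ge0 ?(ltW rho0) //.
  by apply: sumr_ge0 => l _; rewrite exprn_ge0 ?(ltW rho0).
apply: le_trans (rankin X (cmult_expr rho) _ _ _) _.
- by rewrite Omega1.
- by move=> n _; rewrite exprn_ge0 ?(ltW rho0).
- by move=> q; rewrite mem_primes_upto => /andP[pq _]; rewrite /Omega padd_prime.
rewrite (eq_big_seq (fun=> k.+1%:R)) => [|q]; last first.
  rewrite mem_primes_upto => /andP[pq _].
  by rewrite /Omega padd_prime // expr1 rhoE invrK.
rewrite big_const_seq iter_mulr_1 ler_weXn2l ?ler1n //.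
rewrite count_predT size_filter (leq_trans (count_size _ _)) //.
by rewrite size_iota.
Qed.

(** For the k-th power, Parseval on the vertical line bounds the l2 norm of the coefficients by S^k.
    Cauchy-Schwarz over their sparse support then bounds the value at any [g], with a loss
    polynomial in k that disappears on taking k-th roots. *)
Lemma dsum_le_sup N a g : cadd g -> normc (dsum N a g) <= sup_imag_axis N a.
Proof.
move=> gD; set S := sup_imag_axis N a.
have S0 : 0 <= S by exact: sup_imag_axis_ge0.
have n0 := @normc_ge0 R; rewrite -(@ler_pXn2r _ 2) ?nnegrE //.
apply: (@tensor_power_trick _ _ (expR N%:R) N.+1) => //; rewrite ?sqr_ge0 ?expR_gt0 //.
move=> k k0; have [c [cE c0]] := dsumX N a k.
have c2 : \sum_(1 <= l < (N ^ k).+1) normc (c l) ^+ 2 <= (S ^+ k) ^+ 2.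
  apply: mean_square_le_sup => t; rewrite -cE; last exact: cadd_vert.
  by rewrite normcX lerXn2r ?nnegrE // le_dsum_sup.
rewrite -exprM mulnC exprM -[_ ^+ k]normcX cE // -[S ^+ 2 ^+ k]exprM mulnC exprM.
pose P l := smooth (primes_upto N) l && (Omega l <= k * N)%N.
apply: (@le_trans _ _ ((\sum_(1 <= l < (N ^ k).+1 | P l) 1 * normc (c l)) ^+ 2)).
  rewrite lerXn2r ?nnegrE //; first by apply: sumr_ge0 => l _; rewrite mul1r.
  apply: le_trans (normc_dsum_le _ _ _) _; rewrite [leRHS]big_mkcond.
  apply: ler_sum => l _; rewrite mul1r; case: ifP => // Pl.
  have [->|/c0 [l0 sl Ol]] := eqVneq (c l) 0; first by rewrite normc0.
  by move: Pl; rewrite /P sl Ol.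
apply: le_trans (cauchy_schwarz_sum _ _ _ _) _; under eq_bigr do rewrite expr1n.
apply: ler_pM => //; try by apply: sumr_ge0 => l _; rewrite ?sqr_ge0.
  exact: smooth_count.
apply: le_trans c2; rewrite big_mkcond; apply: ler_sum => l _.
by case: ifP; rewrite ?sqr_ge0.
Qed.

End Kronecker.

(** * Projections and derivatives on the polytorus *)

Section Projections.
Local Open Scope complex_scope.
Local Notation Re := complex.Re.
Local Notation Im := complex.Im.
Variables (R : realType) (N : nat).
Implicit Types (a b c : nat -> R[i]) (g : nat -> R) (f : nat -> nat) (S : R).

Definition torus_bounded a S := forall g, cadd g -> normc (dsum N a g) <= S.

Definition restr (P : pred nat) a n := if P n then a n else 0.

(** The twists g + (s / M) f are again completely additive. Averaging them over [s] against the
    phase of -k s / M keeps the terms with f n = k; [M] exceeds k and all values of [f], so that the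
    frequencies (f n - k) / M lie in [-1, 1]. *)
Lemma torus_bounded_level f (k : nat) a S : cadd (fun n => (f n)%:R : R) ->
  torus_bounded a S -> torus_bounded (restr (fun n => f n == k) a) S.
Proof.
move=> fD aS g gD; pose M := (\sum_(i < N) f i.+1 + k).+1.
have M0 : 0 < M%:R :> R by rewrite ltr0n.
pose th (i : 'I_N) : R := ((f i.+1)%:R - k%:R) / M%:R.
have th1 i : `|th i| <= 1.
  rewrite /th normrM normfV ler_pdivrMr ?normr_gt0 ?gt_eqF // mul1r.
  rewrite (ger0_norm (ltW M0)) ler_norml.
  have fM : (f i.+1)%:R <= M%:R :> R.
    by rewrite ler_nat /M (bigD1 i) //= -addnA -addnS leq_addr.
  have kM : k%:R <= M%:R :> R by rewrite ler_nat /M; apply: leqW; exact: leq_addl.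
  move: fM kM (ler0n R (f i.+1)) (ler0n R k).
  by move: (_%:R) (k%:R) (M%:R) => u v w *; lra.
have [C HC] := cesaro_cis (fun i : 'I_N => a i.+1 * cis (g i.+1)) th1.
apply: (@le_of_natmul _ _ _ C) => T.
have -> : dsum N (restr (fun n => f n == k) a) g =
    \sum_(i < N | th i == 0) a i.+1 * cis (g i.+1).
  rewrite dsum_ord [RHS]big_mkcond; apply: eq_bigr => i _; rewrite /restr /th.
  rewrite mulf_eq0 invr_eq0 (gt_eqF M0) orbF subr_eq0 eqr_nat.
  by case: ifP; rewrite // mul0r.
set X := \sum_(i | th i == 0) _ in HC *.
have HS : normc (\sum_(s < T) \sum_(i < N) a i.+1 * cis (g i.+1) * cis (th i *+ s)) <= S *+ T.
  apply: le_trans (normc_sum _ _ _) _.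
  rewrite -[T in leRHS]card_ord -sumr_const; apply: ler_sum => s _.
  pose g' n := g n + s%:R / M%:R * (f n)%:R.
  have g'D : cadd g'.
    by move=> m n m0 n0; rewrite /g' gD // fD // mulrDr addrACA.
  have -> : \sum_(i < N) a i.+1 * cis (g i.+1) * cis (th i *+ s)
      = cis (- (k%:R * s%:R / M%:R)) * dsum N a g'.
    rewrite dsum_ord mulr_sumr; apply: eq_bigr => i _.
    rewrite mulrCA -!mulrA -!cisD; congr (_ * cis _).
    by rewrite /g' /th -[_ *+ s]mulr_natr; ring.
  by rewrite normcM normc_cis mul1r; exact: aS.
rewrite -normcMnat -[X *+ T](subrK (\sum_(s < T) \sum_(i < N) a i.+1 * cis (g i.+1) * cis (th i *+ s))).
apply: le_trans (le_normcD _ _) _; rewrite addrC lerD //.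
by rewrite normcB_sym.
Qed.

Lemma torus_bounded_levels (l : seq ((nat -> nat) * nat)) a S :
    (forall i, (i < size l)%N -> cadd (fun n => ((nth (fun=> 0%N, 0%N) l i).1 n)%:R : R)) ->
  torus_bounded a S -> torus_bounded (restr (fun n => all (fun p => p.1 n == p.2) l) a) S.
Proof.
elim: l => [|[f k] l IH] lD aS; first exact: aS.
have := torus_bounded_level k (lD 0%N isT) (IH (fun i => lD i.+1) aS).
move=> H g gD; have := H g gD; congr (normc _ <= _); apply: eq_bigr => n _.
by rewrite /restr /=; case: eqP; case: all.
Qed.

Lemma torus_bounded_ge0 a S : torus_bounded a S -> 0 <= S.
Proof.
move=> /(_ (fun=> 0)) aS; apply: le_trans (normc_ge0 _) (aS _).
by move=> m n _ _; rewrite addr0.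
Qed.

(* Sorting the terms by the value of f bounds the "derivative" of the sum along f. *)
Lemma torus_bounded_weight f m a S : cadd (fun n => (f n)%:R : R) ->
    (forall n, (0 < n <= N)%N -> (f n <= m)%N) ->
  torus_bounded a S -> torus_bounded (fun n => a n *+ f n) (m%:R ^+ 2 * S).
Proof.
move=> fD fm aS g gD; have S0 := torus_bounded_ge0 aS.
have -> : dsum N (fun n => a n *+ f n) g =
    \sum_(k < m.+1) dsum N (restr (fun n => f n == k) a) g *+ k.
  under eq_bigr do rewrite /dsum -sumrMnl.
  rewrite exchange_big; apply: eq_big_nat => n /andP[n0 nN].
  have fn : (f n < m.+1)%N by rewrite ltnS fm // n0.
  rewrite (bigD1 (Ordinal fn)) //= big1 => [|k kn].
    by rewrite addr0 /restr eqxx mulrnAl.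
  rewrite /restr ifF ?mul0r ?mul0rn //; apply: contraNF kn => /eqP fk.
  by apply/eqP/val_inj; rewrite /= fk.
apply: le_trans (normc_sum _ _ _) _.
apply: (@le_trans _ _ (\sum_(k < m.+1) S *+ k)).
  by apply: ler_sum => k _; rewrite normcMnat lerMn2r torus_bounded_level ?orbT.
rewrite big_ord_recl mulr0n add0r.
apply: (@le_trans _ _ (\sum_(k < m) S *+ m)).
  by apply: ler_sum => k _; apply: ler_wpMn2l => //; exact: (ltn_ord k).
by rewrite sumr_const card_ord -mulrnA -[_ *+ _]mulr_natl natrM expr2.
Qed.

Lemma sum_norm_le_subsets (I : finType) (x : I -> R) (B : R) :
  (forall A : {pred I}, `|\sum_(i | i \in A) x i| <= B) -> \sum_i `|x i| <= 2 * B.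
Proof.
move=> H; rewrite (bigID (fun i => 0 <= x i)) /= mulr2n mulrDl mul1r; apply: lerD.
  apply: le_trans (H [pred i | 0 <= x i]); apply: le_trans (ler_norm _).
  by rewrite le_eqVlt; apply/orP; left; apply/eqP; apply: eq_bigr => i; exact: ger0_norm.
apply: le_trans (H [pred i | ~~ (0 <= x i)]); rewrite -normrN; apply: le_trans (ler_norm _).
rewrite -sumrN le_eqVlt; apply/orP; left; apply/eqP; apply: eq_bigr => i.
by rewrite -ltNge => /ltW; exact: ler0_norm.
Qed.

(** For any set A of primes, the derivatives D_q with q in A add up to the derivative along the
    function counting prime factors in A, which is at most m^2 S. Choosing A by sign, for real and
    for imaginary parts, gives the factor 2 + 2. *)
Lemma torus_bounded_primes m a S g : (forall n, (0 < n <= N)%N -> (Omega n <= m)%N) ->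
    torus_bounded a S -> cadd g ->
  \sum_(q < N.+1) normc (dsum N (fun n => a n *+ logn q n) g) <= 4 * (m%:R ^+ 2 * S).
Proof.
move=> Om aS gD.
have bnd (A : {pred 'I_N.+1}) :
    normc (\sum_(q in A) dsum N (fun n => a n *+ logn q n) g) <= m%:R ^+ 2 * S.
  pose w q : nat := if insub q is Some i then (i : 'I_N.+1) \in A else false.
  have w1 q : (w q <= 1)%N by rewrite /w; case: insub => [i|]; rewrite ?leq_b1.
  have wD : cadd (fun n => (padd w n)%:R : R) by exact: cadd_natr_padd.
  have := torus_bounded_weight wD _ aS gD; move=> /(_ m) H; apply: le_trans (H _); last first.
    by move=> n n0; apply: leq_trans (Om n n0); apply: leq_padd.
  rewrite le_eqVlt; apply/orP; left; apply/eqP; congr normc.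
  rewrite /dsum exchange_big; apply: eq_big_nat => n /andP[n0 nN].
  rewrite -mulr_suml sumrMnr; congr (_ *+ _ * _).
  rewrite (@padd_widen _ _ n N) // big_mkcond; apply: eq_bigr => q _.
  rewrite /w insubT ?ltn_ord // => qN.
  rewrite (_ : Sub (val q) qN = q); last exact: val_inj.
  case: ifP => _; last by rewrite mul0rn.
  by elim: (logn q n) => // k IH; rewrite mulrS -IH.
apply: (@le_trans _ _ (\sum_(q < N.+1) (`|Re (dsum N (fun n => a n *+ logn q n) g)|
   + `|Im (dsum N (fun n => a n *+ logn q n) g)|))).
  by apply: ler_sum => q _; exact: ler_normc_ReIm.
rewrite big_split /= (_ : 4 = 2 + 2); last by rewrite -natrD.
rewrite mulrDl; apply: lerD; apply: sum_norm_le_subsets => A; apply: le_trans (bnd A).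
  by rewrite -Re_sum; exact: ler_norm_Re.
by rewrite -Im_sum; exact: ler_norm_Im.
Qed.

End Projections.

(** * From first to second moments *)

Section MeanToSquareMean.
Local Open Scope complex_scope.
Variables (R : realType) (N : nat).
Implicit Types (a b c : nat -> R[i]) (g : nat -> R) (S : R).

Definition pair_count b l := #|[pred p : 'I_N * 'I_N |
  [&& (p.1.+1 * p.2.+1 == l)%N, b p.1.+1 != 0 & b p.2.+1 != 0]]|.

(** The left side is the fourth moment of the sum with coefficients [b]. Each coefficient of its
    square has at most D nonzero terms, to which Cauchy-Schwarz applies. *)
Lemma conv_square_sum b D : (forall l, (0 < l)%N -> (pair_count b l <= D)%N) ->
  \sum_(1 <= l < (N * N).+1) normc (conv N N b b l) ^+ 2
    <= D%:R * (\sum_(1 <= n < N.+1) normc (b n) ^+ 2) ^+ 2.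
Proof.
move=> HD; pose F (p : 'I_N * 'I_N) := normc (b p.1.+1 * b p.2.+1).
have FE : (\sum_(1 <= n < N.+1) normc (b n) ^+ 2) ^+ 2 = \sum_p F p ^+ 2.
  rewrite expr2 sum_nat_ord mulr_suml.
  rewrite -(pair_bigA _ (fun i j => F (i, j) ^+ 2)) /=; apply: eq_bigr => i _.
  by rewrite mulr_sumr; apply: eq_bigr => j _; rewrite /F normcM exprMn.
rewrite FE sum_by_product mulr_sumr; apply: ler_sum_nat => l /andP[l0 _].
pose P := [pred p : 'I_N * 'I_N |
  [&& (p.1.+1 * p.2.+1 == l)%N, b p.1.+1 != 0 & b p.2.+1 != 0]].
have F0 (p : 'I_N * 'I_N) : (p.1.+1 * p.2.+1 == l)%N -> ~~ P p -> F p = 0.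
  move=> /eqP pl /=; rewrite pl eqxx /= negb_and !negbK /F normcM.
  by case/orP => /eqP ->; rewrite normc0 ?mul0r ?mulr0.
apply: (@le_trans _ _ ((\sum_(p | P p) F p) ^+ 2)).
  have sum0 (Q : pred ('I_N * 'I_N)) : 0 <= \sum_(p | Q p) F p.
    by apply: sumr_ge0 => p _; exact: normc_ge0.
  apply: lerXn2r; rewrite ?nnegrE ?normc_ge0 ?sum0 //.
  apply: le_trans (normc_sum _ _ _) _.
  rewrite [X in _ <= X]big_mkcond [X in X <= _]big_mkcond.
  apply: ler_sum => p _; case: (boolP (P p)) => [Pp|Pp].
    by case: ifP => // _; exact: normc_ge0.
  by case: ifP => // pl; rewrite -/(F p) F0.
apply: le_trans (sum_sqr_card _ _) _; apply: ler_pM; rewrite ?ler0n //.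
- by apply: sumr_ge0 => p _; rewrite sqr_ge0.
- by rewrite ler_nat; exact: HD.
rewrite [X in _ <= X]big_mkcond [X in X <= _]big_mkcond; apply: ler_sum => p _.
case: (boolP (P p)) => [/andP[-> _] //|_].
by case: (_ == l); rewrite ?sqr_ge0.
Qed.

(** With u = x / lam this reads u^2 - u^4 <= u. Being linear in the three powers, it passes to
    averages directly, and takes the place of Hoelder's inequality between the first, second and
    fourth moments. *)
Lemma sqr_le_linear_quartic (x lam : R) : 0 <= x -> 0 < lam ->
  x ^+ 2 / lam - x ^+ 4 / lam ^+ 3 <= x.
Proof.
move=> x0 l0; have l3 : 0 < lam ^+ 3 by rewrite exprn_gt0.
rewrite -(ler_pM2r l3) mulrBl divfK ?gt_eqF // exprSr mulrA divfK ?gt_eqF //.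
have [xl|lx] := leP x lam.
  have : x * (x * lam ^+ 2) <= lam * (x * lam ^+ 2).
    by rewrite ler_wpM2r // mulr_ge0 // sqr_ge0.
  have : 0 <= x ^+ 4 by rewrite exprn_ge0.
  by rewrite !exprS !expr0; lra.
have x2 : lam ^+ 2 <= x ^+ 2 by apply: lerXn2r; rewrite ?nnegrE ?(ltW l0) // ltW.
have : x ^+ 2 * lam ^+ 2 <= x ^+ 2 * x ^+ 2 by rewrite ler_wpM2l ?sqr_ge0.
have : 0 <= x * lam ^+ 3 by rewrite mulr_ge0 // ltW.
by rewrite !exprS !expr0; lra.
Qed.

(** A converse to the bound of the L1 mean by the L2 mean. The step 1 / N^2 is fine enough for the
    squared sum too, which has length N^2. *)
Lemma mean_lower_bound b D : (0 < D)%N ->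
    (forall l, (0 < l)%N -> (pair_count b l <= D)%N) ->
  exists C : R, forall T,
    (Num.sqrt (\sum_(1 <= n < N.+1) normc (b n) ^+ 2) / Num.sqrt (8 * D%:R)) *+ T
      <= \sum_(s < T) normc (dsum N b (vert (s%:R / (N * N)%:R))) + C.
Proof.
move=> D0 HD; set A := \sum_(1 <= n < N.+1) _.
have A0 : 0 <= A by apply: sumr_ge0 => n _; rewrite sqr_ge0.
have [AE|An0] := eqVneq A 0.
  exists 0 => T; rewrite AE sqrtr0 mul0r mul0rn addr0.
  by apply: sumr_ge0 => s _; exact: normc_ge0.
have Ap : 0 < A by rewrite lt_neqAle eq_sym An0.
have Dp : 0 < D%:R :> R by rewrite ltr0n.
have NN : (N <= N * N)%N by case: (N) => // n; rewrite leq_pmulr.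
have [C1 H1] := mean_square_vert b NN.
have [C2 H2] := mean_square_vert (conv N N b b) (leqnn (N * N)).
have := conv_square_sum HD; rewrite -/A in H1 *; set F := \sum_(_ <= _ < _) _ in H2 *.
(* The second moment is A and the fourth at most D A^2. This [lam] makes the quartic term half of
   the quadratic one and leaves A / (2 lam) = sqrt A / sqrt (8 D). *)
move=> FA; pose lam := Num.sqrt (2 * D%:R * A).
have lam2 : lam ^+ 2 = 2 * D%:R * A by rewrite sqr_sqrtr // !mulr_ge0.
have lam0 : 0 < lam by rewrite sqrtr_gt0 !mulr_gt0.
exists (C1 / lam + C2 / lam ^+ 3) => T.
have h : \sum_(s < T) (normc (dsum N b (vert (s%:R / (N * N)%:R))) ^+ 2 / lam
   - normc (dsum (N * N) (conv N N b b) (vert (s%:R / (N * N)%:R))) ^+ 2 / lam ^+ 3)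
   <= \sum_(s < T) normc (dsum N b (vert (s%:R / (N * N)%:R))).
  apply: ler_sum => s _; rewrite -dsumM; last exact: cadd_vert.
  rewrite normcM -expr2 -exprM; apply: sqr_le_linear_quartic => //; exact: normc_ge0.
rewrite sumrB -!mulr_suml in h.
have {}H1 := H1 T; have {}H2 := H2 T; move: h H1 H2.
move: (\sum_(s < T) _) (\sum_(s < T) _) (\sum_(s < T) _) => x4 x2 x1 h.
have := ler_wMn2r T FA; rewrite -(mulr_natr F) -(mulr_natr A) -(mulr_natr (Num.sqrt _ / _)).
rewrite -(mulr_natr (D%:R * _)); move: (T%:R) => t FT.
rewrite !ler_norml => /andP[h1 _] /andP[_ h2].
have il : 0 < lam^-1 by rewrite invr_gt0.
have il3 : 0 < lam ^- 3 by rewrite invr_gt0 exprn_gt0.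
have e1 : (A * t - C1) / lam <= x2 / lam by rewrite ler_pM2r //; lra.
have e2 : x4 / lam ^+ 3 <= (D%:R * A ^+ 2 * t + C2) / lam ^+ 3.
  by rewrite ler_pM2r //; lra.
have key : Num.sqrt A / Num.sqrt (8 * D%:R) = A / lam - D%:R * A ^+ 2 / lam ^+ 3.
  have -> : D%:R * A ^+ 2 / lam ^+ 3 = A / lam / 2.
    by rewrite (exprSr lam) lam2; field; rewrite !gt_eqF.
  have -> : A / lam - A / lam / 2 = A / (2 * lam) by field; rewrite gt_eqF.
  have -> : 2 * lam = Num.sqrt A * Num.sqrt (8 * D%:R).
    rewrite /lam -{1}[2]ger0_norm // -sqrtr_sqr -!sqrtrM ?sqr_ge0 //.
    by congr Num.sqrt; ring.
  rewrite -{2}(sqr_sqrtr A0); field.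
  by rewrite !sqrtr_eq0 -!ltNge Ap mulr_gt0.
rewrite key mulrBl; move: e1 e2 h; rewrite !mulrDl !mulNr !(mulrAC _ t).
move: (A / lam * t) (D%:R * A ^+ 2 / lam ^+ 3 * t) => u v.
lra.
Qed.

Lemma sum_sqrt_le (I : finType) (b : I -> nat -> R[i]) D (B : R) : (0 < D)%N ->
    (forall i l, (0 < l)%N -> (pair_count (b i) l <= D)%N) ->
    (forall t, \sum_i normc (dsum N (b i) (vert t)) <= B) ->
  \sum_i Num.sqrt (\sum_(1 <= n < N.+1) normc (b i n) ^+ 2) <= Num.sqrt (8 * D%:R) * B.
Proof.
move=> D0 HD HB.
have s0 : 0 < Num.sqrt (8 * D%:R) :> R by rewrite sqrtr_gt0 mulr_gt0 ?ltr0n.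
rewrite mulrC -ler_pdivrMr // mulr_suml.
pose C i := sval (cid (mean_lower_bound D0 (HD i))).
apply: (@le_of_natmul _ _ _ (\sum_i C i)) => T.
rewrite -sumrMnl; apply: (@le_trans _ _
  (\sum_i (\sum_(s < T) normc (dsum N (b i) (vert (s%:R / (N * N)%:R))) + C i))).
  by apply: ler_sum => i _; rewrite /C; case: cid => c /= /(_ T).
rewrite big_split lerD2r exchange_big -[T in leRHS]card_ord -sumr_const.
by apply: ler_sum => s _; exact: HB.
Qed.

End MeanToSquareMean.

(** * Upper bound for the Sidon constant *)

Section SidonUpper.
Local Open Scope complex_scope.
Variables (R : realType) (N : nat).
Implicit Types (a b c : nat -> R[i]) (g : nat -> R) (S : R).

(** A prime q >= 17 exceeds 2^4, so 4 q^(-3/4) <= 1/2, safely below the 2/3 reached in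
    [rankin_weight_small]. *)
Definition tiny_bound := 17%N.

(* Primes below 17 are left out because Rankin's method needs 4 q^(-3/4) < 1. *)
Definition Omega17 := padd (fun q => nat_of_bool (tiny_bound <= q)%N).

Lemma Omega17M m n : (0 < m)%N -> (0 < n)%N ->
  Omega17 (m * n) = (Omega17 m + Omega17 n)%N.
Proof. exact: cadd_padd. Qed.

Definition rough := [pred q : nat | (tiny_bound <= q)%N].

Lemma logn_partn q (pi : nat_pred) n : (0 < n)%N ->
  logn q n`_pi = ((q \in pi) * logn q n)%N.
Proof.
move=> n0; have notin (rho : nat_pred) : q \notin rho -> logn q n`_rho = 0%N.
  move=> qr; apply/eqP; rewrite -leqn0 leqNgt logn_gt0 primes_part mem_filter.
  by rewrite (negbTE qr).
have [qpi|/notin //] := boolP (q \in pi); rewrite mul1n -[in RHS](partnC pi n0).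
by rewrite lognM ?part_gt0 // (notin (negn pi)) ?addn0 // inE /= negbK.
Qed.

Lemma Omega_rough n : (0 < n)%N -> Omega (n`_rough) = Omega17 n.
Proof.
move=> n0; rewrite /Omega /Omega17 (@padd_widen _ _ _ n); last first.
  by rewrite dvdn_leq // dvdn_part.
apply: eq_bigr => q _; rewrite logn_partn // inE.
by case: (_ <= _)%N; rewrite ?mul1n ?mul0n ?mulr0n ?mul0rn.
Qed.

(** The index 1 is not prime and its [logn] would vanish identically; its slot carries [Omega17]
    instead, so that one function on 17 indices records a whole class. *)
Definition level_fun (i : nat) : nat -> nat := if i == 1%N then Omega17 else logn i.

Definition level_class (f : {ffun 'I_tiny_bound -> nat}) n :=
  all (fun p : (nat -> nat) * nat => p.1 n == p.2)
    [seq (level_fun (i : 'I_tiny_bound), f i) | i <- enum 'I_tiny_bound].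

Lemma level_classP (f : {ffun 'I_tiny_bound -> nat}) n :
  reflect (forall i : 'I_tiny_bound, level_fun i n = f i) (level_class f n).
Proof.
rewrite /level_class all_map; apply: (iffP allP) => [H i|H i _ /=]; last by rewrite H.
by apply/eqP; apply: (H i); rewrite mem_enum.
Qed.

Lemma level_fun_cadd i : cadd (fun n => (level_fun i n)%:R : R).
Proof.
rewrite /level_fun; case: eqP => _; first exact: cadd_natr_padd.
by move=> m n m0 n0; rewrite lognM // natrD.
Qed.

Lemma torus_bounded_class f a S : torus_bounded N a S ->
  torus_bounded N (restr (level_class f) a) S.
Proof.
apply: torus_bounded_levels => i; rewrite size_map => iI.
by rewrite (nth_map (inord 0)) //=; exact: level_fun_cadd.
Qed.

Lemma level_class_rough_inj f n m : (0 < n)%N -> (0 < m)%N ->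
  level_class f n -> level_class f m -> (n`_rough = m`_rough)%N -> n = m.
Proof.
move=> n0 m0 /level_classP fn /level_classP fm nm.
apply: eqn_from_log => // q; have [qr|qr] := boolP (q \in rough).
  by have := congr1 (logn q) nm; rewrite !logn_partn // qr !mul1n.
have q17 : (q < tiny_bound)%N by rewrite ltnNge.
have := fn (Ordinal q17); rewrite -fm /level_fun /=.
by case: eqP => [->|//]; rewrite /logn.
Qed.

(** Within a class, n is determined by its rough part, and n' by n and l. That rough part divides
    the rough part of l, which has 2 d prime factors and hence at most 2^(2 d) divisors. *)
Lemma class_pair_count (f : {ffun 'I_tiny_bound -> nat}) a l : (0 < l)%N ->
  (pair_count N (restr (level_class f) a) l <= 4 ^ f (inord 1))%N.
Proof.
move=> l0; rewrite /pair_count; set P := [pred p | _].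
have [p0 /= p0P|P0] := pickP P; last by rewrite (eq_card0 P0).
have inP p : P p -> [/\ (p.1.+1 * p.2.+1 = l)%N, level_class f p.1.+1 & level_class f p.2.+1].
  rewrite /P /= /restr => /and3P[/eqP ->]; case: ifP => [c1 _|]; last by rewrite eqxx.
  by case: ifP => [c2 _|]; last by rewrite eqxx.
have Om n : level_class f n -> Omega17 n = f (inord 1).
  by move=> /level_classP /(_ (inord 1)); rewrite /level_fun inordK.
have Ol : Omega (l`_rough) = (2 * f (inord 1))%N.
  have [<- c1 c2] := inP _ p0P.
  by rewrite Omega_rough ?muln_gt0 // Omega17M // !Om // mul2n addnn.
have -> : (4 ^ f (inord 1) = 2 ^ Omega (l`_rough))%N by rewrite Ol expnM.
apply: leq_trans (size_divisors_Omega (part_gt0 _ _)).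
pose F (p : 'I_N * 'I_N) := ((p.1.+1)`_rough)%N.
rewrite cardE -(size_map F); apply: uniq_leq_size.
  rewrite map_inj_in_uniq ?enum_uniq // => p q; rewrite !mem_enum => /inP[pl p1 _] /inP[ql q1 _].
  move/(level_class_rough_inj (ltn0Sn _) (ltn0Sn _) p1 q1) => [/val_inj e1].
  have : (p.1.+1 * p.2.+1 = p.1.+1 * q.2.+1)%N by rewrite pl e1 ql.
  move/eqP; rewrite eqn_pmul2l // eqSS => /eqP /val_inj e2.
  by case: p q e1 e2 {pl p1 ql q1} => [p1 p2] [q1 q2] /= -> ->.
move=> d /mapP[p]; rewrite mem_enum => /inP[pl _ _] ->.
rewrite -dvdn_divisors ?part_gt0 // -pl partnM // /F dvdn_mulr //.
Qed.

Lemma le_sidon_bound (C : R) : (0 < N)%N ->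
    (forall a, \sum_(1 <= n < N.+1) normc (a n) <= C * sup_imag_axis N a) ->
  sidon R N <= C.
Proof. by move=> N0 HC; have [_] := @sidon_least R N N0; apply. Qed.

Lemma sum_from2_le X (F : nat -> R) : (forall n, 0 <= F n) ->
  \sum_(2 <= n < X.+1) F n <= \sum_(1 <= n < X.+1) F n.
Proof.
move=> F0; case: X => [|X]; first by rewrite !big_geq.
by rewrite [leRHS]big_ltn // lerDr.
Qed.

(** The loss sqrt (4^d) of the moment comparison is absorbed by the count: inside the class
    [4 ^ Omega17 n] is 4^d, so at most V / 4^d of its members have a given largest prime q. For
    these v_q(n) >= 1, hence |a_n| is at most the coefficient of D_q in absolute value. *)
Lemma class_sum_bound (f : {ffun 'I_tiny_bound -> nat}) m (V : R) a S :
    (forall n, (0 < n <= N)%N -> (Omega n <= m)%N) ->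
    (forall q, \sum_(2 <= n < N.+1 | max_pdiv n == q) (4 ^ Omega17 n)%:R <= V) ->
    torus_bounded N a S ->
  \sum_(2 <= n < N.+1 | level_class f n) normc (a n)
    <= Num.sqrt 8 * Num.sqrt V * (4 * (m%:R ^+ 2 * S)).
Proof.
move=> Om HV aS; pose d := f (inord 1); set b := restr (level_class f) a.
have bS : torus_bounded N b S by exact: torus_bounded_class.
pose bq (q : 'I_N.+1) n := b n *+ logn q n.
have D0 : (0 < 4 ^ d)%N by rewrite expn_gt0.
have := @sum_sqrt_le R N _ bq _ (4 * (m%:R ^+ 2 * S)) D0 _ _.
have pc (q : 'I_N.+1) l : (0 < l)%N -> (pair_count N (bq q) l <= 4 ^ d)%N.
  move=> l0; apply: leq_trans (class_pair_count f a l0); apply: subset_leq_card.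
  apply/fintype.subsetP => p; rewrite !inE /bq => /and3P[-> /= h1 h2].
  by apply/andP; split; [apply: contraNneq h1|apply: contraNneq h2] => e; rewrite /b e mul0rn.
move=> /(_ pc) H; have {}H := H (fun t => torus_bounded_primes Om bS (cadd_vert t)).
have V0 : 0 <= V.
  apply: le_trans (HV 0%N); apply: sumr_ge0 => n _; exact: ler0n.
have S0 := torus_bounded_ge0 aS.
pose A (q : 'I_N.+1) := \sum_(1 <= n < N.+1) normc (bq q n) ^+ 2.
have mp n : (1 < n <= N)%N -> (max_pdiv n < N.+1)%N.
  by case/andP=> n1 nN; rewrite ltnS (leq_trans _ nN) // dvdn_leq ?max_pdiv_dvd // ltnW.
have key (q : 'I_N.+1) :
    \sum_(2 <= n < N.+1 | level_class f n && (max_pdiv n == q)) normc (a n)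
      <= Num.sqrt (V / (4 ^ d)%:R) * Num.sqrt (A q).
  have A0 : 0 <= A q by apply: sumr_ge0 => n _; exact: sqr_ge0.
  rewrite -sqrtrM ?divr_ge0 ?ler0n // -[leLHS]ger0_norm; last first.
    by apply: sumr_ge0 => n _; exact: normc_ge0.
  rewrite -sqrtr_sqr ler_wsqrtr //.
  under eq_bigr do rewrite -[normc _]mul1r.
  apply: le_trans (cauchy_schwarz_sum _ _ _ _) _; apply: ler_pM.
  - by apply: sumr_ge0 => n _; exact: sqr_ge0.
  - by apply: sumr_ge0 => n _; exact: sqr_ge0.
  - rewrite ler_pdivlMr ?ltr0n // mulr_suml; apply: le_trans (HV q).
    rewrite big_mkcond [leRHS]big_mkcond; apply: ler_sum => n _.
    case: ifP => [/andP[/level_classP /(_ (inord 1)) fn ->]|_]; last first.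
      by case: ifP => // _; exact: ler0n.
    by rewrite expr1n mul1r /d -fn /level_fun inordK.
  apply: le_trans (sum_from2_le N (F := fun n => normc (bq q n) ^+ 2) (fun n => sqr_ge0 _)).
  rewrite big_mkcond; apply: ler_sum_nat => n /andP[n2 nN].
  case: ifP => [/andP[cn /eqP nq]|_]; last exact: sqr_ge0.
  apply: lerXn2r; rewrite ?nnegrE ?normc_ge0 // /bq /b /restr cn normcMnat -nq.
  rewrite -{1}[normc _]mulr1n; apply: ler_wpMn2l; first exact: normc_ge0.
  rewrite logn_gt0 mem_primes max_pdiv_prime // max_pdiv_dvd andbT /=.
  exact: leq_trans n2.
have -> : \sum_(2 <= n < N.+1 | level_class f n) normc (a n) =
    \sum_(q < N.+1) \sum_(2 <= n < N.+1 | level_class f n && (max_pdiv n == q)) normc (a n).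
  under [RHS]eq_bigr do rewrite big_mkcond.
  rewrite exchange_big big_mkcond; apply: eq_big_nat => n n2.
  case: (level_class f n) => /=; last by rewrite big1.
  rewrite -big_mkcond (big_pred1 (Ordinal (mp n n2))) //.
apply: le_trans (ler_sum _ (fun q _ => key q)) _.
rewrite -mulr_sumr; apply: le_trans (ler_wpM2l (sqrtr_ge0 _) H) _.
have D1 : 0 < (4 ^ d)%:R :> R by rewrite ltr0n.
have e : Num.sqrt (V / (4 ^ d)%:R) * Num.sqrt (8 * (4 ^ d)%:R) = Num.sqrt 8 * Num.sqrt V.
  rewrite -!sqrtrM ?divr_ge0 ?(ltW D1) //; congr Num.sqrt.
  by rewrite mulrA mulrAC divfK ?gt_eqF // mulrC.
by rewrite -e !mulrA.
Qed.

Lemma partition_classes m (x : nat -> R) X Y : (forall n, 0 <= x n) ->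
    (forall n, (X <= n < Y)%N -> (forall i, (level_fun i n <= m)%N)) ->
  \sum_(X <= n < Y) x n <=
    \sum_(f : {ffun 'I_tiny_bound -> 'I_m.+1})
      \sum_(X <= n < Y | level_class [ffun i => val (f i)] n) x n.
Proof.
move=> x0 lm; under [leRHS]eq_bigr do rewrite big_mkcond.
rewrite exchange_big; apply: ler_sum_nat => n nY; rewrite -big_mkcond.
pose f := [ffun i : 'I_tiny_bound => inord (level_fun i n) : 'I_m.+1].
rewrite (bigD1 f) /=; first by rewrite lerDl sumr_ge0.
by apply/level_classP => i; rewrite !ffunE /= inordK // ltnS lm.
Qed.

Lemma level_fun_Omega i n : (0 < n)%N -> (level_fun i n <= Omega n)%N.
Proof.
move=> n0; rewrite /level_fun; case: eqP => _.
  by apply: leq_padd => q; exact: leq_b1.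
have [->//|/logn_leq /andP[iN _]] := eqVneq (logn i n) 0%N.
rewrite /Omega /padd (bigD1 (inord i)) //= inordK //.
apply: leq_trans (leq_addr _ _).
by elim: (logn i n) => // k IH; rewrite mulrS.
Qed.

(* For a fixed pattern of exponents of the primes below 17 and a fixed number of
   larger prime factors, the 4th moment is at most 4^d times the square of the 2nd,
   which turns the pointwise bound for the sum over the primes q of |D_q Q| into
   one for mean squares. *)
Theorem sidon_upper m (V : R) : (0 < N)%N ->
    (forall n, (0 < n <= N)%N -> (Omega n <= m)%N) ->
    (forall q, \sum_(2 <= n < N.+1 | max_pdiv n == q) (4 ^ Omega17 n)%:R <= V) ->
  sidon R N <= 1 + m.+1%:R ^+ 17 * (Num.sqrt 8 * Num.sqrt V * (4 * m%:R ^+ 2)).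
Proof.
move=> N0 Om HV; apply: le_sidon_bound => // a; set S := sup_imag_axis N a.
have aS : torus_bounded N a S by move=> g; exact: dsum_le_sup.
have S0 := torus_bounded_ge0 aS.
(* The integer 1 has no largest prime factor; Parseval bounds its coefficient, which accounts for
   the summand 1. *)
have a1 : normc (a 1%N) <= S.
  have := @mean_square_le_sup R N a S (fun t => aS _ (cadd_vert t)).
  rewrite big_ltn // => H; rewrite -(@ler_pXn2r _ 2) ?nnegrE ?normc_ge0 //.
  apply: le_trans H; rewrite lerDl; apply: sumr_ge0 => n _; exact: sqr_ge0.
rewrite big_ltn // mulrDl mul1r; apply: lerD => //.
apply: le_trans (@partition_classes m _ _ _ _ _) _ => [n|n n2 i|].
- exact: normc_ge0.
- have n0 : (0 < n)%N by case/andP: n2 => n2 _; apply: leq_trans n2.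
  apply: leq_trans (level_fun_Omega i n0) (Om n _).
  by rewrite n0; case/andP: n2.
apply: (@le_trans _ _ (\sum_(f : {ffun 'I_tiny_bound -> 'I_m.+1})
    Num.sqrt 8 * Num.sqrt V * (4 * (m%:R ^+ 2 * S)))).
  by apply: ler_sum => f _; exact: class_sum_bound.
rewrite sumr_const card_ffun !card_ord -(mulr_natl _ (m.+1 ^ tiny_bound)) natrX.
by rewrite !mulrA.
Qed.

End SidonUpper.

(** * Mertens' estimates *)

Section PrimeSums.
Variable R : realType.
Implicit Types (q n B K : nat).

Local Notation lnn n := (ln (n%:R : R)).

Lemma lnn_ge0 n : 0 <= lnn n.
Proof. by case: n => [|n]; [rewrite ln0|rewrite ln_ge0 // ler1n]. Qed.

Lemma ln2_ge_half : 2^-1 <= ln (2 : R).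
Proof.
have : ln (1 + (- 2^-1)) <= - 2^-1 :> R by apply: le_ln1Dx; lra.
have -> : 1 + - 2^-1 = 2^-1 :> R by lra.
by rewrite lnV ?posrE // lerN2.
Qed.

Lemma lnn_primes B n : (0 < n <= B)%N ->
  lnn n = \sum_(1 <= q < B.+1 | prime q) (logn q n)%:R * lnn q.
Proof.
case/andP=> n0 nB; rewrite (cadd_eq_padd (@cadd_ln R) n0) (padd_widen _ nB).
rewrite -(big_mkord xpredT (fun q => lnn q *+ logn q n)) big_ltn //.
rewrite mulr0n add0r [RHS]big_mkcond; apply: eq_bigr => q _; case: ifP => pq.
  by rewrite mulr_natl.
by rewrite /logn pq mulr0n.
Qed.

(** The exponent of the prime q in n!. The next lemma is Legendre's formula in recursive form. *)
Definition sum_logn q n := (\sum_(1 <= k < n.+1) logn q k)%N.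

Lemma sum_lognE q n : prime q -> sum_logn q n = (n %/ q + sum_logn q (n %/ q))%N.
Proof.
move=> pq; have q0 := prime_gt0 pq; rewrite /sum_logn (bigID (fun k => q %| k)%N) /=.
have -> : (\sum_(1 <= k < n.+1 | q %| k) logn q k =
    \sum_(1 <= r < (n %/ q).+1) logn q (q * r))%N := sum_multiples n (logn q) q0.
rewrite addnC big1 => [|k qk]; last by rewrite lognE (negbTE qk) !andbF.
rewrite add0n (eq_big_nat _ _ (F2 := fun r => (1 + logn q r)%N)) => [|r /andP[r0 _]].
  by rewrite big_split /= sum_nat_const_nat muln1 subn1.
by rewrite lognM // logn_prime // eqxx.
Qed.

Lemma sum_logn_le q n : prime q -> (sum_logn q n * q.-1 <= n)%N.
Proof.
move=> pq; have q1 := prime_gt1 pq; elim/ltn_ind: n => n IH.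
have [->|n0] := posnP n; first by rewrite /sum_logn big_geq.
rewrite sum_lognE // mulnDl.
apply: leq_trans (leq_add (leqnn _) (IH _ _)) _; first by rewrite ltn_Pdiv.
rewrite -{2}[(n %/ q)%N]muln1 -mulnDr addn1 prednK ?prime_gt0 //.
exact: leq_trunc_div.
Qed.

Lemma sum_lnn n B : (n <= B)%N ->
  \sum_(1 <= k < n.+1) lnn k = \sum_(1 <= q < B.+1 | prime q) (sum_logn q n)%:R * lnn q.
Proof.
move=> nB; rewrite (eq_big_nat _ _ (F2 := fun k =>
  \sum_(1 <= q < B.+1 | prime q) (logn q k)%:R * lnn q)) => [|k /andP[k0 kn]]; last first.
  by apply: lnn_primes; rewrite k0 (leq_trans _ nB).
rewrite exchange_big; apply: eq_bigr => q _.
by rewrite -mulr_suml natr_sum.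
Qed.

Lemma sum_lnn_ge n : n%:R * lnn n - n%:R <= \sum_(1 <= k < n.+1) lnn k.
Proof.
elim: n => [|n IH]; first by rewrite big_geq // mul0r subr0.
rewrite big_nat_recr //=; apply: le_trans (lerD IH (lexx _)).
have [->|n0] := posnP n; first by rewrite ln1 mulr0 mul0r; lra.
have np : 0 < n%:R :> R by rewrite ltr0n.
have : lnn n.+1 - lnn n <= n%:R^-1.
  rewrite -ln_div ?posrE ?ltr0n //.
  have -> : n.+1%:R / n%:R = 1 + n%:R^-1 :> R.
    by rewrite -natr1 mulrDl divff ?gt_eqF // mul1r.
  by apply: le_ln1Dx; apply: lt_trans (ltrN10 _) _; rewrite invr_gt0.
rewrite -(ler_pM2l np) mulfV ?gt_eqF // mulrBr.
by rewrite -natr1; lra.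
Qed.

Lemma sum_lnn_le n : \sum_(1 <= k < n.+1) lnn k <= n%:R * lnn n.
Proof.
apply: (@le_trans _ _ (\sum_(1 <= k < n.+1) lnn n)).
  apply: ler_sum_nat => k /andP[k0 kn]; have n0 : (0 < n)%N := leq_trans k0 kn.
  by rewrite ler_ln ?posrE ?ltr0n ?ler_nat.
by rewrite sumr_const_nat subn1 mulr_natl.
Qed.

(** Compare ln (Kn)! <= Kn ln (Kn) with the contribution of the primes q <= n, whose exponents in
    (Kn)! are at least floor (Kn / q) >= (K - 1) n / q. A large K brings the leading constant close
    to 1 without any prior bound of Chebyshev type. *)
Lemma mertens_upper K n : (1 < K)%N -> (0 < n)%N ->
  \sum_(1 <= q < n.+1 | prime q) lnn q / q%:R
    <= K%:R / K.-1%:R * (lnn n + lnn K).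
Proof.
move=> K1 n0; have K0 : (0 < K)%N by apply: ltnW.
have K1p : 0 < K.-1%:R :> R by rewrite ltr0n -ltnS prednK.
have np : 0 < n%:R :> R by rewrite ltr0n.
rewrite mulrAC ler_pdivlMr // -(ler_pM2r np).
have -> : K%:R * (lnn n + lnn K) * n%:R = (K * n)%:R * lnn (K * n).
  by rewrite cadd_ln // natrM; ring.
apply: le_trans (sum_lnn_le (K * n)); rewrite (@sum_lnn (K * n) (K * n)) //.
rewrite [leRHS](@big_cat_nat _ _ _ n.+1) //=; last by rewrite ltnS leq_pmull.
rewrite -[leLHS]addr0; apply: lerD; last first.
  by apply: sumr_ge0 => q _; rewrite mulr_ge0 ?ler0n ?lnn_ge0.
rewrite -mulrA mulr_suml big_mkcond [leRHS]big_mkcond.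
apply: ler_sum_nat => q /andP[q0 qn]; case: ifP => // pq.
have qp : 0 < q%:R :> R by rewrite ltr0n.
rewrite -mulrA mulrC ler_wpM2r ?lnn_ge0 // mulrC ler_pdivrMr //.
rewrite -!natrM ler_nat.
have h1 : (K * n %/ q <= sum_logn q (K * n))%N by rewrite (sum_lognE _ pq) leq_addr.
have h2 := ltn_ceil (K * n) q0; have h3 : (q <= n)%N by [].
case: K {K1p} K1 K0 h1 h2 => // K _ _ h1 h2 /=; nia.
Qed.

(** The right side vanishes at n = 1 and grows at each step by at least the new term, because ln (k
    + 1) - ln k <= 1 / k. *)
Lemma lnn_telescope n :
  \sum_(2 <= k < n.+1) lnn k / (k%:R * k.-1%:R) <= 2 - (lnn n + 2) / n%:R.
Proof.
case: n => [|n]; first by rewrite big_geq // invr0 mulr0 subr0.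
elim: n => [|n IH]; first by rewrite big_geq // ln1 divr1 add0r subrr.
rewrite big_nat_recr //=; apply: le_trans (lerD IH (lexx _)) _.
have n1 : 0 < n.+1%:R :> R by rewrite ltr0n.
have n2 : 0 < n.+2%:R :> R by rewrite ltr0n.
rewrite -subr_ge0.
have -> : 2 - (lnn n.+2 + 2) / n.+2%:R -
    (2 - (lnn n.+1 + 2) / n.+1%:R + lnn n.+2 / (n.+2%:R * n.+1%:R))
  = (2 - n.+2%:R * (lnn n.+2 - lnn n.+1)) / (n.+2%:R * n.+1%:R).
  move: (lnn n.+2) (lnn n.+1) => a b; rewrite -(@natr1 R n.+1).
  rewrite -(@natr1 R n.+1) in n2; field; by rewrite !gt_eqF.
apply: divr_ge0; last by rewrite mulr_ge0 ?ltW.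
have : lnn n.+2 - lnn n.+1 <= n.+1%:R^-1.
  rewrite -ln_div ?posrE //.
  have -> : n.+2%:R / n.+1%:R = 1 + n.+1%:R^-1 :> R.
    by rewrite -(@natr1 R n.+1) mulrDl divff ?gt_eqF // mul1r.
  by apply: le_ln1Dx; apply: lt_trans (ltrN10 _) _; rewrite invr_gt0.
rewrite -(ler_pM2l n2) => /le_trans H; rewrite subr_ge0; apply: H.
rewrite ler_pdivrMr // -natrM ler_nat; lia.
Qed.

(** Of the 3, 1 comes from ln n! >= n ln n - n, and 2 from replacing q - 1 by q, where q - 1 stems
    from the bound n / (q - 1) for the exponent of q in n!. *)
Lemma mertens_lower n : (0 < n)%N ->
  lnn n - 3 <= \sum_(1 <= q < n.+1 | prime q) lnn q / q%:R.
Proof.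
move=> n0; have np : 0 < n%:R :> R by rewrite ltr0n.
have h1 : lnn n - 1 <= \sum_(1 <= q < n.+1 | prime q) lnn q / q.-1%:R.
  rewrite -(ler_pM2l np) mulrBr mulr1; apply: le_trans (sum_lnn_ge n) _.
  rewrite (sum_lnn (leqnn n)) mulr_sumr; apply: ler_sum => q pq.
  have q1 : 0 < q.-1%:R :> R by rewrite ltr0n -ltnS prednK ?prime_gt0 ?prime_gt1.
  rewrite mulrCA mulrC ler_wpM2l ?lnn_ge0 // ler_pdivlMr // -natrM ler_nat.
  exact: sum_logn_le.
have h2 : \sum_(1 <= q < n.+1 | prime q) lnn q / (q%:R * q.-1%:R) <= 2.
  apply: (@le_trans _ _ (\sum_(2 <= k < n.+1) lnn k / (k%:R * k.-1%:R))).
    rewrite [leLHS]big_mkcond big_ltn //= add0r; apply: ler_sum => k _.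
    by case: ifP => // _; rewrite divr_ge0 ?mulr_ge0 ?ler0n ?lnn_ge0.
  apply: le_trans (lnn_telescope n) _.
  by rewrite gerBl divr_ge0 ?ler0n // addr_ge0 ?lnn_ge0.
have : \sum_(1 <= q < n.+1 | prime q) lnn q / q.-1%:R =
   \sum_(1 <= q < n.+1 | prime q) lnn q / q%:R +
   \sum_(1 <= q < n.+1 | prime q) lnn q / (q%:R * q.-1%:R).
  rewrite -big_split; apply: eq_bigr => q pq /=.
  have q1 : 0 < q.-1%:R :> R by rewrite ltr0n -ltnS prednK ?prime_gt0 ?prime_gt1.
  have -> : q%:R = q.-1%:R + 1 :> R by rewrite natr1 prednK ?prime_gt0.
  field; by rewrite !gt_eqF // ltr_wpDr.
lra.
Qed.

End PrimeSums.

(** * Weighted smooth numbers *)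

Section SmoothWeights.
Variable R : realType.
Implicit Types (q n : nat) (kappa w : R).

Local Notation lnn n := (ln (n%:R : R)).

(** This is 4^Omega17(n) n^(kappa - 1); correspondingly [prime_sum] below adds up q^(kappa - 1). *)
Definition rankin_weight kappa n : R :=
  (4 ^ Omega17 n)%:R * expR (- ((1 - kappa) * lnn n)).

Definition prime_sum kappa p : R :=
  \sum_(1 <= q < p.+1 | prime q) expR (kappa * lnn q) / q%:R.

Lemma expR_lnn n : (0 < n)%N -> expR (lnn n) = n%:R.
Proof. by move=> n0; rewrite lnK // posrE ltr0n. Qed.

Lemma rankin_weight_cmult kappa : cmult (rankin_weight kappa).
Proof.
move=> m n m0 n0; rewrite /rankin_weight Omega17M // expnD natrM cadd_ln //.
by rewrite mulrDr opprD expRD; ring.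
Qed.

Lemma rankin_weight_ge0 kappa n : 0 <= rankin_weight kappa n.
Proof. by rewrite mulr_ge0 ?ler0n ?expR_ge0. Qed.

Lemma Omega17_prime q : prime q -> Omega17 q = (tiny_bound <= q)%N.
Proof. by move=> pq; rewrite /Omega17 padd_prime. Qed.

Lemma Omega17_1 : Omega17 1 = 0%N.
Proof. by apply: (@addnI (Omega17 1)); rewrite -Omega17M // mul1n addn0. Qed.

Lemma rankin_weight_prime kappa q : prime q ->
  rankin_weight kappa q <= 4 * (expR (kappa * lnn q) / q%:R).
Proof.
move=> pq; rewrite /rankin_weight Omega17_prime //.
have -> : expR (- ((1 - kappa) * lnn q)) = expR (kappa * lnn q) / q%:R.
  have -> : - ((1 - kappa) * lnn q) = kappa * lnn q - lnn q by ring.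
  by rewrite expRB (expR_lnn (prime_gt0 pq)).
rewrite ler_wpM2r ?divr_ge0 ?expR_ge0 ?ler0n // ler_nat.
by case: (tiny_bound <= q)%N.
Qed.

(** Below 17 the worst case is 2^(-3/4) < 2/3, as (3/2)^4 < 2^3; from 17 on the weight is at most 4
    * 16^(-3/4) = 1/2. Up to x = 2/3 one has 1 / (1 - x) <= 1 + 3 x, which is how Euler factors are
    estimated later. *)
Lemma rankin_weight_small kappa q : kappa <= 4^-1 -> prime q ->
  rankin_weight kappa q <= 2 / 3.
Proof.
move=> k4 pq; rewrite /rankin_weight Omega17_prime //.
have q2 : ln 2 <= lnn q by rewrite ler_ln ?posrE ?ltr0n ?prime_gt0 // ler_nat prime_gt1.
have l2 : 0 < ln 2 :> R by rewrite (lt_le_trans _ (ln2_ge_half R)).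
have k1 : 3 / 4 <= 1 - kappa by lra.
have [q17|q17] := leqP tiny_bound q; last first.
  rewrite expn0 mul1r -[leRHS]lnK ?posrE ?divr_gt0 // ler_expR lerNl -lnV ?posrE ?divr_gt0 //.
  rewrite invf_div; apply: (@le_trans _ _ (3 / 4 * ln 2)); last first.
    by apply: ler_pM => //; lra.
  rewrite -(@ler_pM2l _ 4) // mulrA (_ : 4 * (3 / 4) = 3 :> R); last by field.
  have -> : 4 * ln (3 / 2) = ln ((3 / 2) ^+ 4) :> R by rewrite lnXn ?divr_gt0 // -[RHS]mulr_natl.
  have -> : 3 * ln 2 = ln (2 ^+ 3) :> R by rewrite lnXn // -[RHS]mulr_natl.
  rewrite ler_ln ?posrE ?exprn_gt0 ?divr_gt0 //.
  lra.
have q4 : 4 * ln 2 <= lnn q.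
  have -> : 4 * ln 2 = lnn (2 ^ 4) by rewrite natrX lnXn // -[RHS]mulr_natl.
  have q0 : 0 < q%:R :> R by rewrite ltr0n prime_gt0.
  have t0 : 0 < (2 ^ 4)%:R :> R by rewrite ltr0n.
  by rewrite (ler_ln t0 q0) ler_nat; apply: leq_trans q17.
have : (1 - kappa) * lnn q >= 3 * ln 2.
  apply: (@le_trans _ _ (3 / 4 * (4 * ln 2))); first by rewrite mulrA ler_wpM2r ?(ltW l2) //; lra.
  by apply: ler_pM => //; lra.
rewrite -lerN2 => H; rewrite expn1; rewrite -ler_expR in H.
have e8 : expR (- (3 * ln 2)) = 8^-1 :> R.
  have -> : 3 * ln 2 = ln (2 ^+ 3) :> R by rewrite lnXn // -[RHS]mulr_natl.
  by rewrite expRN lnK ?posrE ?exprn_gt0 // -natrX.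
rewrite e8 in H; lra.
Qed.

(** Write n = p r with r free of primes above p, and insert (N / n)^(1 - kappa) >= 1. The leading 4
    bounds the weight of p itself; 12 is 3 from the Euler factors times 4 from the weight of a
    prime. *)
Lemma sum_max_pdiv_le N p kappa : 0 <= kappa <= 4^-1 ->
  \sum_(2 <= n < N.+1 | max_pdiv n == p) (4 ^ Omega17 n)%:R
    <= 4 * expR ((1 - kappa) * (lnn N - lnn p) + 12 * prime_sum kappa p).
Proof.
case/andP=> k0 k4; have [pp|np] := boolP (prime p); last first.
  rewrite big_nat_cond big1 ?mulr_ge0 ?expR_ge0 // => n /andP[/andP[n2 _] /eqP np'].
  by move: np; rewrite -np' max_pdiv_prime.
have p0 := prime_gt0 pp; pose h := rankin_weight kappa.
have h0 n : 0 <= h n by exact: rankin_weight_ge0.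
have k1 : 0 <= 1 - kappa by lra.
apply: (@le_trans _ _ (expR ((1 - kappa) * lnn N) *
    \sum_(1 <= n < N.+1 | (p %| n)%N) (if smooth (primes_upto p) n then h n else 0))).
  rewrite mulr_sumr [leRHS]big_mkcond [leLHS]big_mkcond.
  apply: le_trans (sum_from2_le N (F := fun n => if (p %| n)%N then
    expR ((1 - kappa) * lnn N) * (if smooth (primes_upto p) n then h n else 0) else 0) _).
    apply: ler_sum_nat => n /andP[n2 nN]; case: eqP => [np|_]; last first.
      by case: ifP => // _; case: ifP => _; rewrite ?mulr0 // mulr_ge0 ?expR_ge0.
    have n0 : (0 < n)%N by apply: leq_trans n2.
    rewrite -np max_pdiv_dvd ifT; last first.
      apply/allP => q qn; rewrite mem_primes_upto max_pdiv_max //.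
      by move: qn; rewrite mem_primes => /and3P[->].
    rewrite /h /rankin_weight mulrCA -expRD -[leLHS]mulr1 ler_wpM2l ?ler0n //.
    apply: le_trans (expR_ge1Dx _); rewrite lerDl -mulrN -mulrDr mulr_ge0 // subr_ge0.
    by rewrite ler_ln ?posrE ?ltr0n ?ler_nat // (leq_trans n0).
  move=> n; case: ifP => // _; case: ifP => _; rewrite ?mulr0 // mulr_ge0 ?expR_ge0 //.
rewrite sum_multiples // (eq_big_nat _ _ (F2 := fun r =>
  h p * (if smooth (primes_upto p) r then h r else 0))); last first.
  move=> r /andP[r0 _]; rewrite smoothM // /h rankin_weight_cmult //.
  rewrite (_ : smooth _ p) /=; first by case: ifP; rewrite ?mulr0.
  by apply: (smooth_le _ (leqnn p)) => q pq qp; rewrite mem_primes_upto pq.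
rewrite -mulr_sumr -big_mkcond /=.
have R1 : \sum_(1 <= r < (N %/ p).+1 | smooth (primes_upto p) r) h r
    <= expR (12 * prime_sum kappa p).
  apply: le_trans (rankin (N %/ p) (rankin_weight_cmult kappa) _ _ _) _.
  - by rewrite /rankin_weight Omega17_1 ln1 mulr0 oppr0 expR0 mulr1.
  - by move=> n _; exact: h0.
  - move=> q; rewrite mem_primes_upto => /andP[pq _]; split=> //.
    by apply: le_lt_trans (rankin_weight_small k4 pq) _; lra.
  apply: (@le_trans _ _ (\prod_(q <- primes_upto p) expR (3 * h q))).
    rewrite big_seq [leRHS]big_seq; apply: ler_prod => q.
    rewrite mem_primes_upto => /andP[pq _].
    have := rankin_weight_small k4 pq; have := h0 q; rewrite -/(h q).
    move: (h q) => x x0 x1; have d0 : 0 < 1 - x by lra.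
    rewrite invr_ge0 (ltW d0) /=; apply: le_trans (expR_ge1Dx _).
    rewrite -(ler_pM2r d0) mulVf ?gt_eqF //; nra.
  rewrite -expR_sum ler_expR -mulr_sumr /prime_sum (_ : 12 = 3 * 4 :> R); last by ring.
  rewrite -mulrA ler_wpM2l // mulr_sumr big_filter.
  rewrite [iota 0 _]/= big_cons [prime 0]/= /index_iota subn1 [p.+1.-1]/=.
  by apply: ler_sum => q pq; exact: rankin_weight_prime.
apply: (@le_trans _ _ (expR ((1 - kappa) * lnn N) *
    (4 * expR (- ((1 - kappa) * lnn p)) * expR (12 * prime_sum kappa p)))).
  rewrite ler_wpM2l ?expR_ge0 //; apply: ler_pM => //; first by apply: sumr_ge0.
  rewrite /h /rankin_weight ler_wpM2r ?expR_ge0 // ler_nat Omega17_prime //.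
  by case: (tiny_bound <= p)%N.
rewrite le_eqVlt; apply/orP; left; apply/eqP.
rewrite mulrA mulrCA -!mulrA -!expRD; congr (4 * expR _); ring.
Qed.

(** Split at ln q = w. Below, q^kappa <= e^(kappa w) and 1 <= 2 ln q; above, q^kappa <= p^kappa and
    1 <= ln q / w. Both parts then follow from the Mertens upper bound with K = 2. *)
Lemma prime_sum_le kappa p w : 0 <= kappa -> 0 < w -> (1 < p)%N ->
  prime_sum kappa p <= 8 * w * expR (kappa * w) + 4 * lnn p * expR (kappa * lnn p) / w.
Proof.
move=> k0 w0 p1; have p0 : (0 < p)%N by apply: ltnW.
have lp : ln 2 <= lnn p by rewrite ler_ln ?posrE ?ltr0n // ler_nat.
have l2 := ln2_ge_half R.
rewrite /prime_sum (bigID (fun q => lnn q <= w)) /=; apply: lerD.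
  have [w2|w2] := ltP w (ln 2).
    rewrite big_nat_cond big1 ?mulr_ge0 ?expR_ge0 ?(ltW w0) // => q.
    case/andP=> /andP[q0 _] /andP[pq qw]; have := le_lt_trans qw w2.
    by rewrite ltr_ln ?posrE ?ltr0n // ltr_nat ltnNge prime_gt1.
  pose n := Num.truncn (expR w).
  have nw : n%:R <= expR w by rewrite truncn_le ?expR_ge0.
  have n0 : (0 < n)%N by rewrite truncn_gt0 ltW // expR_gt1.
  have ln_w : lnn n <= w by rewrite -[leRHS]expRK ler_ln ?posrE ?ltr0n ?expR_gt0.
  apply: (@le_trans _ _ (2 * expR (kappa * w) *
      \sum_(1 <= q < n.+1 | prime q) lnn q / q%:R)); last first.
    rewrite -mulrA (mulrC (8 * w)) mulrCA ler_wpM2l ?expR_ge0 //.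
    have := @mertens_upper R 2 n isT n0; rewrite divr1 => H.
    have : 2%:R * (lnn n + lnn 2) <= 4 * w by lra.
    lra.
  rewrite mulr_sumr; apply: (@le_trans _ _ (\sum_(1 <= q < p.+1 | prime q && (lnn q <= w))
      2 * expR (kappa * w) * (lnn q / q%:R))).
    apply: ler_sum => q /andP[pq qw]; rewrite mulrA ler_wpM2r ?invr_ge0 ?ler0n //.
    have : expR (kappa * lnn q) <= expR (kappa * w) by rewrite ler_expR ler_wpM2l.
    have : ln 2 <= lnn q by rewrite ler_ln ?posrE ?ltr0n ?prime_gt0 // ler_nat prime_gt1.
    move=> ql /le_trans; apply; rewrite mulrAC -[leLHS]mul1r ler_wpM2r ?expR_ge0 //; lra.
  have F0 q : 0 <= 2 * expR (kappa * w) * (lnn q / q%:R).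
    by rewrite !mulr_ge0 ?expR_ge0 ?invr_ge0 ?ler0n ?lnn_ge0.
  have qn q : (0 < q)%N -> lnn q <= w -> (q <= n)%N.
    move=> q0 qw; rewrite truncn_ge_nat ?expR_ge0 //.
    by rewrite -(expR_lnn q0) ler_expR.
  have [pn|pn] := leqP n p; last first.
    rewrite [leRHS](@big_cat_nat _ _ _ p.+1) //=; last by rewrite ltnS ltnW.
    rewrite -[leLHS]addr0; apply: lerD; last by apply: sumr_ge0.
    rewrite big_mkcondr; apply: ler_sum => q _; by case: ifP.
  rewrite [leLHS](@big_cat_nat _ _ _ n.+1) //= [X in _ + X]big_nat_cond.
  rewrite [X in _ + X]big1 ?addr0 => [|q /andP[/andP[nq _] /andP[pq qw]]].
    by rewrite big_mkcondr; apply: ler_sum => q _; case: ifP.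
  by have := qn q (prime_gt0 pq) qw; rewrite leqNgt nq.
apply: (@le_trans _ _ (\sum_(1 <= q < p.+1 | prime q)
    (expR (kappa * lnn p) / w) * (lnn q / q%:R))).
  rewrite big_mkcondr big_nat_cond [leRHS]big_nat_cond.
  apply: ler_sum => q /andP[/andP[q0 qp] pq]; case: ifP => [qw|_]; last first.
    by rewrite !mulr_ge0 ?expR_ge0 ?invr_ge0 ?ler0n ?lnn_ge0 // ltW.
  have qw' : w < lnn q by rewrite ltNge qw.
  rewrite mulrA ler_wpM2r ?invr_ge0 ?ler0n //.
  apply: (@le_trans _ _ (expR (kappa * lnn p))).
    by rewrite ler_expR ler_wpM2l // ler_ln ?posrE ?ltr0n // ler_nat.
  rewrite -mulrA -[leLHS]mulr1 ler_wpM2l ?expR_ge0 // mulrC ler_pdivlMr // mul1r ltW //.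
rewrite -mulr_sumr [leRHS](_ : _ = expR (kappa * lnn p) / w * (4 * lnn p)); last by ring.
rewrite ler_wpM2l ?divr_ge0 ?expR_ge0 ?(ltW w0) //.
have := @mertens_upper R 2 p isT p0; rewrite divr1 => H.
lra.
Qed.

End SmoothWeights.

(** * Smooth numbers and random signs *)

Section SmoothNumbers.
Variable R : realType.
Implicit Types (q n y X : nat).

Local Notation lnn n := (ln (n%:R : R)).

Definition Psi y X : R := \sum_(1 <= n < X.+1 | smooth (primes_upto y) n) 1.

Lemma Psi_ge0 y X : 0 <= Psi y X.
Proof. exact: sumr_ge0. Qed.

Lemma smooth_primes_upto y n : (n <= y)%N -> smooth (primes_upto y) n.
Proof. by apply: smooth_le => q pq qy; rewrite mem_primes_upto pq. Qed.

Lemma Psi_small y X : (X <= y)%N -> Psi y X = X%:R.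
Proof.
move=> Xy; rewrite /Psi big_nat_cond (eq_bigl (fun n => (1 <= n < X.+1)%N && true)).
  by rewrite -big_nat_cond sumr_const_nat subn1.
move=> n; case: (boolP (1 <= n < X.+1)%N) => //= /andP[_ nX].
by rewrite smooth_primes_upto // (leq_trans _ Xy).
Qed.

Lemma sum_dvd_primes_le y n : (0 < n)%N ->
  \sum_(1 <= q < y.+1 | prime q && (q %| n)%N) lnn q <= lnn n.
Proof.
move=> n0; rewrite (@lnn_primes R (maxn n y) n) ?n0 ?leq_maxl //.
rewrite [leRHS](@big_cat_nat _ _ _ y.+1) //=; last by rewrite ltnS leq_maxr.
rewrite -[leLHS]addr0; apply: lerD; last first.
  by apply: sumr_ge0 => q _; rewrite mulr_ge0 ?ler0n ?lnn_ge0.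
rewrite big_mkcondr; apply: ler_sum => q pq; case: ifP => qn; last first.
  by rewrite mulr_ge0 ?ler0n ?lnn_ge0.
rewrite -[leLHS]mul1r ler_wpM2r ?lnn_ge0 // ler1n logn_gt0 mem_primes pq n0.
by rewrite qn.
Qed.

Lemma Psi_recursion y X :
  \sum_(1 <= q < y.+1 | prime q) lnn q * Psi y (X %/ q) <= Psi y X * lnn X.
Proof.
rewrite /Psi mulr_suml.
apply: (@le_trans _ _ (\sum_(1 <= n < X.+1 | smooth (primes_upto y) n)
    \sum_(1 <= q < y.+1 | prime q && (q %| n)%N) lnn q)); last first.
  rewrite big_nat_cond [leRHS]big_nat_cond.
  apply: ler_sum => n /andP[/andP[n0 nX] _]; rewrite mul1r.
  apply: le_trans (sum_dvd_primes_le y n0) _.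
  by rewrite ler_ln ?posrE ?ltr0n ?ler_nat // (leq_trans n0).
under [leRHS]eq_bigr do rewrite big_mkcondr.
rewrite exchange_big /= le_eqVlt; apply/orP; left; apply/eqP.
rewrite big_nat_cond [RHS]big_nat_cond; apply: eq_bigr => q /andP[/andP[q0 qy] pq].
rewrite -big_mkcondr mulr_sumr [RHS]big_mkcondl /= sum_multiples // big_mkcond.
apply: eq_big_nat => r /andP[r0 _].
by rewrite smoothM // (@smooth_primes_upto y q) //=; case: ifP; rewrite ?mulr1.
Qed.

(** Each use of the recursion keeps only the primes with ln q > Z, so ln X drops by at least Z and
    after [i] steps X <= y. The factor lost per step is [om]; the 2 in its hypothesis pays for floor
    (X / q) >= X / (2 q), and [lnn N] instead of [lnn X] makes it the same at every step. *)
Lemma Psi_lower y N (Z om : R) i X : 0 <= om <= 1 -> 0 < lnn N ->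
    om * (2 * lnn N)
      <= \sum_(1 <= q < y.+1 | prime q && (Z < lnn q)) lnn q / q%:R ->
    (0 < X <= N)%N -> (0 < y)%N -> lnn X <= lnn y + i%:R * Z ->
  X%:R * om ^+ i <= Psi y X.
Proof.
move=> /andP[om0 om1] lN omW + y0; elim: i X => [|i IH] X /andP[X0 XN] lX.
  have Xy : (X <= y)%N.
    by rewrite -(ler_nat R) -ler_ln ?posrE ?ltr0n //; move: lX; rewrite mul0r addr0.
  by rewrite expr0 mulr1 Psi_small.
have [Xy|yX] := leqP X y.
  by rewrite Psi_small // ler_piMr ?ler0n // exprn_ile1.
have Xp : 0 < X%:R :> R by rewrite ltr0n.
have P0 := Psi_ge0 y X.
have lXN : lnn X <= lnn N by rewrite ler_ln ?posrE ?ltr0n ?ler_nat ?(leq_trans X0).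
rewrite -(ler_pM2r lN); apply: le_trans (ler_wpM2l P0 lXN).
apply: le_trans (Psi_recursion y X).
apply: (@le_trans _ _ (X%:R / 2 * om ^+ i *
   \sum_(1 <= q < y.+1 | prime q && (Z < lnn q)) lnn q / q%:R)).
  apply: le_trans (ler_wpM2l _ omW); last by rewrite !mulr_ge0 ?exprn_ge0 ?ler0n.
  by rewrite exprS le_eqVlt; apply/orP; left; apply/eqP; field.
rewrite mulr_sumr big_mkcondr big_nat_cond [leRHS]big_nat_cond.
apply: ler_sum => q /andP[/andP[q0 qy] pq].
have qp : 0 < q%:R :> R by rewrite ltr0n.
case: ifP => [Zq|_]; last by rewrite mulr_ge0 ?lnn_ge0 ?Psi_ge0.
have qX : (q <= X)%N by apply: leq_trans (ltnW yX).
have d0 : (0 < X %/ q)%N by rewrite divn_gt0.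
have dX : (X %/ q)%:R <= X%:R / q%:R :> R.
  by rewrite ler_pdivlMr // -natrM ler_nat leq_trunc_div.
have : (X %/ q)%:R * om ^+ i <= Psi y (X %/ q).
  apply: IH; first by rewrite d0 (leq_trans (leq_div _ _)).
  apply: (@le_trans _ _ (lnn X - lnn q)).
    by rewrite -ln_div ?posrE // ler_ln ?posrE ?divr_gt0 ?ltr0n.
  by move: lX; rewrite -natr1; lra.
move/(ler_wpM2l (lnn_ge0 R q)); apply: le_trans.
rewrite [leLHS](_ : _ = lnn q * (X%:R / 2 / q%:R * om ^+ i)); last by ring.
rewrite ler_wpM2l ?lnn_ge0 // ler_wpM2r ?exprn_ge0 //.
rewrite ler_pdivrMr // ler_pdivrMr //.
rewrite -!natrM ler_nat.
have := ltn_ceil X q0; move: (X %/ q)%N d0 => d d0; nia.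
Qed.

End SmoothNumbers.

(** * Signs making many linear forms small simultaneously *)

Section Signs.
Variable R : realType.

Lemma expR_le_quadratic (x : R) : `|x| <= 2^-1 -> expR x <= 1 + x + 2 * x ^+ 2.
Proof.
rewrite ler_norml => /andP[x1 x2]; have d0 : 0 < 1 - x by lra.
rewrite -[x in expR x]opprK expRN -[leLHS]mul1r ler_pdivrMr ?expR_gt0 //.
apply: (@le_trans _ _ ((1 + x + 2 * x ^+ 2) * (1 - x))).
  have : 0 <= x ^+ 2 * (1 - 2 * x) by rewrite mulr_ge0 ?sqr_ge0 //; lra.
  by rewrite !exprS expr0; lra.
rewrite ler_wpM2l ?expR_ge1Dx //.
by have := sqr_ge0 x; lra.
Qed.

Lemma expR_symm_le (x lam : R) : `|x| <= lam -> lam <= 2^-1 ->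
  expR x + expR (- x) <= 2 * expR (2 * lam ^+ 2).
Proof.
move=> xl l2; have xh : `|x| <= 2^-1 by apply: le_trans l2.
have h1 := expR_le_quadratic xh.
have h2 : expR (- x) <= 1 + - x + 2 * (- x) ^+ 2 by apply: expR_le_quadratic; rewrite normrN.
have h3 := expR_ge1Dx (2 * lam ^+ 2).
have : x ^+ 2 <= lam ^+ 2.
  rewrite -(real_normK (num_real x)); apply: lerXn2r; rewrite ?nnegrE //.
  by apply: le_trans xl.
rewrite sqrrN in h2; lra.
Qed.

(* Method of conditional expectations: the signs are chosen one at a time so that
   sum_i 2 cosh(lam S_i) grows at most by the average factor. *)
Lemma exists_signs_potential (I : finType) (F : I -> nat -> R) (lam : R) (s : seq nat) :
    0 <= lam <= 2^-1 -> (forall i n, `|F i n| <= 1) -> uniq s ->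
  exists2 e : nat -> R, (forall n, `|e n| = 1) &
    \sum_i (expR (lam * \sum_(n <- s) e n * F i n)
            + expR (- (lam * \sum_(n <- s) e n * F i n)))
      <= 2 * #|I|%:R * expR (2 * lam ^+ 2) ^+ size s.
Proof.
move=> /andP[l0 l2] F1; elim: s => [_|n s IH /=/andP[ns us]].
  exists (fun=> 1) => [n|]; first by rewrite normr1.
  rewrite expr0 mulr1; under eq_bigr do rewrite big_nil mulr0 oppr0 expR0.
  by rewrite sumr_const -(mulr_natr (1 + 1)).
have [e e1 He] := IH us.
pose S i := \sum_(m <- s) e m * F i m.
pose ext (x : R) m := if m == n then x else e m.
have extS x i : \sum_(m <- n :: s) ext x m * F i m = x * F i n + S i.
  rewrite big_cons /ext eqxx; congr (_ + _); apply: eq_big_seq => m ms.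
  by case: eqP => // mn; move: ns; rewrite -mn ms.
pose Phi (x : R) := \sum_i (expR (lam * (x * F i n + S i)) + expR (- (lam * (x * F i n + S i)))).
have Phi2 : Phi 1 + Phi (- 1) <= 2 * expR (2 * lam ^+ 2) *
    \sum_i (expR (lam * S i) + expR (- (lam * S i))).
  rewrite /Phi -big_split mulr_sumr; apply: ler_sum => i _ /=.
  have h : `|lam * F i n| <= lam.
    by rewrite normrM (ger0_norm l0) ler_piMr.
  have := expR_symm_le h l2.
  have -> : lam * (1 * F i n + S i) = lam * F i n + lam * S i by ring.
  have -> : lam * (- 1 * F i n + S i) = - (lam * F i n) + lam * S i by ring.
  rewrite !opprD opprK !expRD => H.
  apply: le_trans (ler_wpM2r _ H); last by rewrite addr_ge0 ?expR_ge0.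
  rewrite le_eqVlt; apply/orP; left; apply/eqP.
  move: (expR (lam * F i n)) (expR (- (lam * F i n))) => a b.
  move: (expR (lam * S i)) (expR (- (lam * S i))) => c d; ring.
have E0 : 0 <= expR (2 * lam ^+ 2) by exact: expR_ge0.
have HB : Phi 1 + Phi (- 1) <=
    2 * (2 * #|I|%:R * expR (2 * lam ^+ 2) ^+ (size s).+1).
  apply: le_trans Phi2 _; apply: le_trans (ler_wpM2l _ He) _; first by rewrite mulr_ge0.
  by rewrite (exprS (expR _)) le_eqVlt; apply/orP; left; apply/eqP; ring.
have ext1 x : `|x| = 1 -> forall m, `|ext x m| = 1.
  by move=> x1 m; rewrite /ext; case: ifP.
have [P1|P1] := leP (Phi 1) (2 * #|I|%:R * expR (2 * lam ^+ 2) ^+ (size s).+1).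
  exists (ext 1); first by apply: ext1; rewrite normr1.
  by under eq_bigr do rewrite extS.
exists (ext (- 1)); first by apply: ext1; rewrite normrN normr1.
under eq_bigr do rewrite extS.
rewrite -/(Phi (- 1)); lra.
Qed.

Lemma exists_signs (I : finType) (F : I -> nat -> R) (s : seq nat) (B : R) :
    (forall i n, `|F i n| <= 1) -> uniq s -> (0 < #|I|)%N -> 0 < B ->
    ln (2 * #|I|%:R) <= B -> 4 * B <= (size s)%:R ->
  exists2 e : nat -> R, (forall n, `|e n| = 1) &
    forall i, `|\sum_(n <- s) e n * F i n| <= 3 * Num.sqrt (B * (size s)%:R).
Proof.
move=> F1 us I0 B0 IB Bs; have s0 : 0 < (size s)%:R :> R by lra.
(* The potential gives lam |S| <= ln (2 #I) + 2 lam^2 size s. This [lam] makes the last term 2 B, so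
   |S| <= 3 B / lam; [4 * B <= size s] is exactly lam <= 1/2. *)
pose lam := Num.sqrt (B / (size s)%:R).
have lam0 : 0 < lam by rewrite sqrtr_gt0 divr_gt0.
have lam2 : lam ^+ 2 = B / (size s)%:R by rewrite sqr_sqrtr // divr_ge0 ?ltW.
have laml : lam <= 2^-1.
  rewrite -(@ler_pXn2r _ 2) ?nnegrE ?invr_ge0 ?(ltW lam0) // lam2.
  by rewrite ler_pdivrMr // exprVn; lra.
have l12 : 0 <= lam <= 2^-1 by rewrite (ltW lam0).
have [e e1 He] := exists_signs_potential l12 F1 us.
exists e => // i; set S := \sum_(n <- s) _.
have I2 : 0 < 2 * #|I|%:R :> R by rewrite mulr_gt0 ?ltr0n.
have expS : expR (lam * `|S|) <= 2 * #|I|%:R * expR (2 * lam ^+ 2) ^+ size s.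
  apply: le_trans He; rewrite (bigD1 i) //= -/S.
  apply: (@le_trans _ _ (expR (lam * S) + expR (- (lam * S)))); last first.
    by rewrite lerDl; apply: sumr_ge0 => j _; rewrite addr_ge0 ?expR_ge0.
  by case: (ger0P S) => _; rewrite ?mulrN ?lerDl ?lerDr expR_ge0.
have : lam * `|S| <= 3 * B.
  rewrite -ler_expR; apply: le_trans expS _.
  rewrite -expRM_natr -[2 * #|I|%:R]lnK ?posrE // -expRD ler_expR lam2.
  by rewrite mulrA divfK ?gt_eqF //; lra.
rewrite mulrC -ler_pdivlMr // => /le_trans; apply.
rewrite ler_pdivrMr // -mulrA /lam -sqrtrM ?mulr_ge0 ?(ltW B0) ?(ltW s0) //.
rewrite (_ : B * _ * _ = B ^+ 2); last by field; rewrite gt_eqF.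
by rewrite sqrtr_sqr ger0_norm ?(ltW B0).
Qed.

End Signs.

(** * Lower bound for the Sidon constant *)

Section SidonLower.
Local Open Scope complex_scope.
Local Notation Re := complex.Re.
Local Notation Im := complex.Im.
Variable R : realType.
Implicit Types (q n y N M : nat) (t : R).

Local Notation lnn n := (ln (n%:R : R)).

Lemma ImB (z w : R[i]) : Im (z - w) = Im z - Im w.
Proof. by case: z w => [? ?] [? ?]. Qed.

Lemma ReMr (x : R) (z : R[i]) : Re (x%:C * z) = x * Re z.
Proof. by case: z => u v /=; rewrite mul0r subr0. Qed.

Lemma ImMr (x : R) (z : R[i]) : Im (x%:C * z) = x * Im z.
Proof. by case: z => u v /=; rewrite mul0r addr0. Qed.

(** Cells of width 1 / M on [-1, 1]; the endpoint x = 1 falls into a cell of its own, numbered 2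
    M. *)
Definition cell_index M (x : R) : 'I_(2 * M).+1 := inord (Num.truncn ((x + 1) * M%:R)).

Lemma cell_index_close M (x x' : R) : (0 < M)%N -> `|x| <= 1 -> `|x'| <= 1 ->
  cell_index M x = cell_index M x' -> `|x - x'| <= M%:R^-1.
Proof.
move=> M0 x1 x'1; have Mp : 0 < M%:R :> R by rewrite ltr0n.
have nn (z : R) : `|z| <= 1 -> 0 <= (z + 1) * M%:R.
  by rewrite ler_norml => /andP[z1 _]; rewrite mulr_ge0 ?ler0n //; lra.
have bnd (z : R) : `|z| <= 1 -> (Num.truncn ((z + 1) * M%:R) < (2 * M).+1)%N.
  move=> z1; rewrite ltnS truncn_le_nat; move: z1; rewrite ler_norml => /andP[_ z1].
  rewrite -natr1 natrM; apply: (@le_lt_trans _ _ (2 * M%:R)); last by lra.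
  by rewrite ler_wpM2r ?ler0n //; lra.
move=> /(congr1 val); rewrite /= !inordK ?bnd // => E.
have t1 := truncn_itv (nn _ x1); have t2 := truncn_itv (nn _ x'1).
rewrite E in t1; move: t1 t2; move: (Num.truncn _) => k /andP[a1 a2] /andP[b1 b2].
rewrite -(ler_pM2r Mp) mulVf ?gt_eqF // -[X in _ * X](ger0_norm (ltW Mp)) -normrM.
rewrite -natr1 in a2 b2; rewrite ler_norml; lra.
Qed.

Definition cell y M t : {ffun 'I_y.+1 -> 'I_(2 * M).+1 * 'I_(2 * M).+1} :=
  [ffun q : 'I_y.+1 => (cell_index M (Re (cis (vert t q))), cell_index M (Im (cis (vert t q))))].

Lemma cell_close y M t t' q : (0 < M)%N -> (q <= y)%N -> cell y M t = cell y M t' ->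
  normc (cis (vert t q) - cis (vert t' q)) <= 2 / M%:R.
Proof.
move=> M0 qy /ffunP /(_ (Ordinal (qy : (q < y.+1)%N))); rewrite !ffunE => E.
have Er := congr1 fst E; have Ei := congr1 snd E.
have r1 x : `|Re (cis x : R[i])| <= 1 by apply: le_trans (ler_norm_Re _) _; rewrite normc_cis.
have i1 x : `|Im (cis x : R[i])| <= 1 by apply: le_trans (ler_norm_Im _) _; rewrite normc_cis.
apply: le_trans (ler_normc_ReIm _) _; rewrite (_ : 2 = 1 + 1) // mulrDl mul1r.
rewrite ReB ImB.
by apply: lerD; apply: cell_index_close (r1 _) (r1 _) Er || apply: cell_index_close (i1 _) (i1 _) Ei.
Qed.

(** For unit complex numbers |u v - u' v'| <= |u - u'| + |v - v'|, so errors add up over the prime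
    factors counted with multiplicity. *)
Lemma smooth_close y t t' (d : R) n : (0 < n)%N ->
    (forall q, prime q -> (q <= y)%N -> normc (cis (vert t q) - cis (vert t' q)) <= d) ->
  smooth (primes_upto y) n ->
  normc (cis (vert t n) - cis (vert t' n)) <= (Omega n)%:R * d.
Proof.
move=> + Hd; move: n; apply: cadd_ind => [_|q n pq n0 IH].
  by rewrite /vert ln1 !mulr0 subrr normc0 Omega1 mul0r.
have q0 := prime_gt0 pq; rewrite smoothM // => /andP[sq sn].
have qy : (q <= y)%N.
  by move: sq; rewrite /smooth primes_prime //= andbT mem_primes_upto => /andP[].
rewrite !cadd_vert // !cisD OmegaM // {1}/Omega padd_prime // natrD mulrDl mul1r.
set u := cis (vert t q); set v := cis (vert t n).
set u' := cis (vert t' q); set v' := cis (vert t' n).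
have -> : u * v - u' * v' = (u - u') * v + u' * (v - v') by ring.
apply: le_trans (le_normcD _ _) _; rewrite !normcM !normc_cis mulr1 mul1r.
by apply: lerD; [exact: Hd|exact: IH].
Qed.

Lemma size_smooth y N :
  (size [seq n <- index_iota 1 N.+1 | smooth (primes_upto y) n])%:R = Psi R y N.
Proof.
by rewrite size_filter -sum1_count natr_sum.
Qed.

(* Random signs on the y-smooth integers up to N; as n^(-it) only depends on the
   values p^(-it), p <= y, a net of (2 N^2 + 1)^(2 (y + 1)) points t is enough. *)
Lemma exists_small_sup y N : (1 < N)%N -> (0 < y)%N ->
    72 * (y%:R * lnn N) <= Psi R y N ->
  exists2 a : nat -> R[i],
    \sum_(1 <= n < N.+1) normc (a n) = Psi R y N &
    sup_imag_axis N a <= 8 * Num.sqrt (18 * (y%:R * lnn N) * Psi R y N).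
Proof.
move=> N1 y0 HP; have N0 : (0 < N)%N by apply: ltnW.
have Np : 0 < N%:R :> R by rewrite ltr0n.
(* A cell of side 1 / N^2 changes each n^(-it) by at most Omega(n) * 2 / N^2 <= 2 / N, hence the
   whole sum by at most 2. *)
pose M := (N ^ 2)%N; have M0 : (0 < M)%N by rewrite expn_gt0 N0.
pose s := [seq n <- index_iota 1 N.+1 | smooth (primes_upto y) n].
pose I := ({ffun 'I_y.+1 -> 'I_(2 * M).+1 * 'I_(2 * M).+1} * bool)%type.
pose rep (k : {ffun 'I_y.+1 -> 'I_(2 * M).+1 * 'I_(2 * M).+1}) : R :=
  xget 0 [set t | cell y M t = k].
have repE t : cell y M (rep (cell y M t)) = cell y M t.
  by rewrite /rep; case: xgetP => [_ -> //|/(_ t)] /=.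
pose F (i : I) n := if i.2 then Re (cis (vert (rep i.1) n)) else Im (cis (vert (rep i.1) n)).
have F1 i n : `|F i n| <= 1.
  by rewrite /F; case: i.2; apply: le_trans (ler_norm_Re _) _ || apply: le_trans (ler_norm_Im _) _;
     rewrite normc_cis.
have us : uniq s by rewrite filter_uniq // iota_uniq.
have I0 : (0 < #|{: I}|)%N by rewrite card_prod card_ffun card_bool muln_gt0 expn_gt0 card_prod !card_ord.
have lN : 2^-1 <= lnn N.
  by apply: le_trans (ln2_ge_half R) _; rewrite ler_ln ?posrE ?ltr0n // ler_nat.
have yp : 1 <= y%:R :> R by rewrite ler1n.
have yN : 2^-1 <= y%:R * lnn N by rewrite -[leLHS]mul1r; apply: ler_pM.
(* As 2 M + 1 <= N^4, the quantity ln (2 #I) is at most (2 + 8 (y + 1)) ln N <= 18 y ln N. The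
   hypothesis with 72 = 4 * 18 becomes [4 * B <= size s]. *)
pose B : R := 18 * (y%:R * lnn N).
have B0 : 0 < B by rewrite mulr_gt0 //; lra.
have IB : ln (2 * #|{: I}|%:R) <= B.
  rewrite card_prod card_ffun card_bool card_prod !card_ord.
  have h1 : (2 * M).+1%:R <= N%:R ^+ 4 :> R.
    rewrite -natrX ler_nat /M; move: N1; clear; nia.
  have -> : 2 * (((2 * M).+1 * (2 * M).+1) ^ y.+1 * 2)%:R =
      2 ^+ 2 * ((2 * M).+1%:R ^+ 2) ^+ y.+1 :> R.
    by rewrite natrM natrX natrM !expr2; ring.
  rewrite -exprM lnM ?posrE ?exprn_gt0 // !lnXn //.
  have h2 : ln (2 * M).+1%:R <= 4 * lnn N.
    by rewrite mulr_natl -lnXn // ler_ln ?posrE ?exprn_gt0.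
  have h3 : ln 2 <= lnn N by rewrite ler_ln ?posrE ?ltr0n // ler_nat.
  rewrite -(mulr_natl (ln 2)) -(mulr_natl (ln (2 * M).+1%:R)) natrM -[y.+1%:R]natr1.
  move: h2 h3 yp lN; rewrite /B; move: (ln (2 * M).+1%:R) (ln 2) (lnn N) (y%:R) => m2 l2 l Y.
  move=> h2 h3 yp lN.
  have : (Y + 1) * m2 <= (Y + 1) * (4 * l) by rewrite ler_wpM2l //; lra.
  have : l <= Y * l by rewrite ler_peMl //; lra.
  lra.
have sP : (size s)%:R = Psi R y N by exact: size_smooth.
have Bs : 4 * B <= (size s)%:R by rewrite sP /B; lra.
have [e e1 He] := exists_signs F1 us I0 B0 IB Bs.
pose a n : R[i] := if smooth (primes_upto y) n then (e n)%:C else 0.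
have normE n : normc (a n) = if smooth (primes_upto y) n then 1 else 0.
  by rewrite /a; case: ifP => _; rewrite ?normc0 // normc_real e1.
exists a.
  by under eq_bigr do rewrite normE; rewrite -big_mkcond.
have dsumE t : dsum N a (vert t) = \sum_(n <- s) (e n)%:C * cis (vert t n).
  rewrite /s big_filter big_mkcond; apply: eq_bigr => n _.
  by rewrite /a; case: ifP => _; rewrite ?mul0r.
(* The factor 8 is 3 + 3 for the real and imaginary parts at the net points, plus 2 for moving to
   the nearest of them. *)
set X := Num.sqrt (B * Psi R y N); rewrite -/B.
have rep_bound k : normc (dsum N a (vert (rep k))) <= 6 * X.
  apply: le_trans (ler_normc_ReIm _) _; rewrite (_ : 6 * X = 3 * X + 3 * X); last by ring.
  rewrite dsumE Re_sum Im_sum /X -sP; apply: lerD.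
    have := He (k, true); congr (`|_| <= _); apply: eq_bigr => n _.
    by rewrite ReMr.
  have := He (k, false); congr (`|_| <= _); apply: eq_bigr => n _.
  by rewrite ImMr.
have X1 : 1 <= X.
  rewrite -[leLHS]sqrtr1 ler_wsqrtr // /B.
  rewrite -[leLHS]mulr1.
  by apply: ler_pM => //; lra.
apply: sup_le_ub; first by exists (normc (dirichlet_poly N a (0 +i* 0))), 0.
move=> _ [t _ <-]; rewrite dirichlet_polyE.
pose t' := rep (cell y M t).
have -> : dsum N a (vert t) = dsum N a (vert t') + (dsum N a (vert t) - dsum N a (vert t')).
  by rewrite addrC subrK.
apply: le_trans (le_normcD _ _) _; rewrite (_ : 8 * X = 6 * X + 2 * X); last by ring.
apply: lerD; first exact: rep_bound.
apply: (@le_trans _ _ 2); last by lra.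
rewrite /dsum -sumrB; apply: le_trans (normc_sum _ _ _) _.
apply: (@le_trans _ _ (\sum_(1 <= n < N.+1) 2 / N%:R)); last first.
  by rewrite sumr_const_nat subn1 /= -(mulr_natr (2 / _)) divfK ?gt_eqF.
apply: ler_sum_nat => n /andP[n0 nN]; rewrite -mulrBr normcM normE.
case: ifP => sn; last by rewrite mul0r divr_ge0 ?ler0n.
rewrite mul1r; apply: le_trans (smooth_close (d := 2 / M%:R) n0 _ sn) _.
  by move=> q pq qy; apply: (cell_close M0 qy); rewrite /t' repE.
have On : (Omega n)%:R <= N%:R :> R.
  rewrite ler_nat; apply: leq_trans (nN : (n <= N)%N); apply: leq_trans (expn_Omega n0).
  exact/ltnW/ltn_expl.
apply: (@le_trans _ _ (N%:R * (2 / M%:R))); first by rewrite ler_wpM2r // divr_ge0 ?ler0n.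
by rewrite /M natrX le_eqVlt; apply/orP; left; apply/eqP; field; rewrite gt_eqF.
Qed.

Theorem sidon_lower y N : (1 < N)%N -> (0 < y)%N ->
    72 * (y%:R * lnn N) <= Psi R y N ->
  Num.sqrt (Psi R y N / (18 * (y%:R * lnn N))) / 8 <= sidon R N.
Proof.
move=> N1 y0 HP; have N0 : (0 < N)%N by apply: ltnW.
have [a aE aS] := exists_small_sup N1 y0 HP.
have [sb _] := sidon_least R N0; have := sb a; rewrite aE.
have lN : 0 < lnn N by rewrite ln_gt0 // ltr1n.
have yp : 0 < y%:R :> R by rewrite ltr0n.
set B := 18 * (y%:R * lnn N); have B0 : 0 < B by rewrite !mulr_gt0.
have P0 : 0 < Psi R y N by apply: lt_le_trans HP; rewrite !mulr_gt0.
move: aS; rewrite -/B; move: (Psi R y N) P0 => P P0 aS Ps.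
have s0 : 0 <= sidon R N.
  by apply: lb_le_inf; [exact: sidon_bounds_nonempty|exact: sidon_bounds_ge0].
have : P <= sidon R N * (8 * Num.sqrt (B * P)) by apply: le_trans Ps _; rewrite ler_wpM2l.
have BP0 : 0 < Num.sqrt (B * P) by rewrite sqrtr_gt0 mulr_gt0.
rewrite -ler_pdivrMr; last by rewrite mulr_gt0.
apply: le_trans; rewrite le_eqVlt; apply/orP; left; apply/eqP.
have e : P = Num.sqrt (P / B) * Num.sqrt (B * P).
  rewrite -sqrtrM ?divr_ge0 ?(ltW P0) ?(ltW B0) //.
  have -> : P / B * (B * P) = P ^+ 2 by field; rewrite gt_eqF.
  by rewrite sqrtr_sqr ger0_norm ?(ltW P0).
by rewrite [X in _ = X / _]e; field; rewrite gt_eqF.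
Qed.

End SidonLower.

(** * Asymptotics *)

Section Growth.
Variable R : realType.
Implicit Types (l eta A beta eps delta : R).

(* The scale sqrt(log N log log N) as a function of l = log log N. *)
Definition scale l : R := Num.sqrt (expR l * l).

Lemma near_ge A : \forall l \near +oo, A <= l.
Proof. by apply: nbhs_pinfty_ge; exact: num_real. Qed.

Lemma scale_ge0 l : 0 <= scale l.
Proof. exact: sqrtr_ge0. Qed.

Lemma sqr_scale l : 0 <= l -> scale l ^+ 2 = expR l * l.
Proof. by move=> l0; rewrite sqr_sqrtr // mulr_ge0 ?expR_ge0. Qed.

Lemma expR_half_le_scale l : 1 <= l -> expR (l / 2) <= scale l.
Proof.
move=> l1; rewrite -[leLHS]ger0_norm ?expR_ge0 // -sqrtr_sqr /scale ler_wsqrtr //.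
rewrite -expRM_natr divfK //; apply: le_trans (ler_wpM2l (expR_ge0 _) l1).
by rewrite mulr1.
Qed.

Lemma expR_ge_square l : 0 <= l -> l ^+ 2 / 2 <= expR l.
Proof.
by move=> l0; have := @expR_ge1Dxn _ l 1 l0; rewrite (_ : 2`! = 2)%N //; lra.
Qed.

Lemma near_le_expR beta eta : 0 < beta -> 0 < eta ->
  \forall l \near +oo, l <= eta * expR (beta * l).
Proof.
move=> b0 e0; near=> l.
have l0 : 0 < l by near: l; apply: nbhs_pinfty_gt; exact: num_real.
have h : 2 / (eta * beta ^+ 2) <= l by near: l; exact: near_ge.
have := @expR_ge_square (beta * l) (mulr_ge0 (ltW b0) (ltW l0)).
move/(ler_wpM2l (ltW e0)); apply: le_trans.
rewrite ler_pdivrMr ?mulr_gt0 ?exprn_gt0 // in h.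
have -> : eta * ((beta * l) ^+ 2 / 2) = l * (l * (eta * beta ^+ 2) / 2) by ring.
rewrite ler_peMr ?(ltW l0) //. lra.
Unshelve. all: by end_near. Qed.

Lemma near_le_scale eta : 0 < eta -> \forall l \near +oo, l <= eta * scale l.
Proof.
move=> e0; near=> l.
have h : l <= eta * expR (2^-1 * l) by near: l; exact: near_le_expR.
have l1 : 1 <= l by near: l; exact: near_ge.
apply: le_trans h _; rewrite ler_wpM2l ?(ltW e0) // mulrC.
exact: expR_half_le_scale.
Unshelve. all: by end_near. Qed.

Lemma near_cst_le_scale A eta : 0 < eta -> \forall l \near +oo, A <= eta * scale l.
Proof.
move=> e0; near=> l; apply: (@le_trans _ _ l); first by near: l; exact: near_ge.
by near: l; exact: near_le_scale.
Unshelve. all: by end_near. Qed.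

Lemma near_expR_neg beta eta : 0 < beta -> 0 < eta ->
  \forall l \near +oo, expR (- (beta * l)) <= eta.
Proof.
move=> b0 e0; near=> l.
rewrite -[leRHS](lnK (_ : eta \is Num.pos)) ?posrE // ler_expR lerNl.
rewrite mulrC -ler_pdivrMr //; near: l; exact: near_ge.
Unshelve. all: by end_near. Qed.

Lemma near_power_le_scale beta eta : 0 < beta -> 0 < eta ->
  \forall l \near +oo, expR ((2^-1 - beta) * l) <= eta * scale l.
Proof.
move=> b0 e0; near=> l.
have h : expR (- (beta * l)) <= eta by near: l; exact: near_expR_neg.
have l1 : 1 <= l by near: l; exact: near_ge.
rewrite mulrBl expRD mulrC; apply: ler_pM; rewrite ?expR_ge0 // mulrC.
exact: expR_half_le_scale.
Unshelve. all: by end_near. Qed.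

Lemma near_scale_le eta : 0 < eta -> \forall l \near +oo, scale l <= eta * expR l.
Proof.
move=> e0; near=> l.
have l0 : 0 <= l by near: l; exact: near_ge.
have h : l <= eta ^+ 2 * expR (1 * l) by near: l; apply: near_le_expR; rewrite ?exprn_gt0.
have E0 := expR_ge0 l.
rewrite -[leRHS]ger0_norm ?mulr_ge0 ?(ltW e0) // -sqrtr_sqr /scale ler_wsqrtr //.
rewrite mul1r in h; rewrite exprMn mulrC (expr2 (expR l)) mulrA ler_wpM2r //.
Unshelve. all: by end_near. Qed.

Lemma near_lnln (P : R -> Prop) : (\forall l \near +oo, P l) ->
  \forall N \near \oo, P (ln (ln N%:R)).
Proof.
move=> [M [_ HM]]; exists (Num.truncn (expR (expR M))).+1 => // N /= HN.
apply: HM.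
have h : expR (expR M) < N%:R.
  by apply: lt_le_trans (truncnS_gt _) _; rewrite ler_nat.
have e1 : expR M < ln N%:R.
  by rewrite -[ltLHS]expRK ltr_ln ?posrE ?expR_gt0 // (lt_trans (expR_gt0 _) h).
by rewrite -[ltLHS]expRK ltr_ln ?posrE ?expR_gt0 // (lt_trans (expR_gt0 _) e1).
Qed.

(* The two regimes: for Y >= L/4 this is Y + L^2/(2Y) >= sqrt 2 L, and for Y < L/4
   the second term alone is at least 2 (1 - rho) L. *)
Lemma exponent_optimum (L Y rho eps : R) : 0 < L -> 0 <= Y -> 0 < rho ->
    rho <= 4^-1 -> 4 * rho <= eps ->
  let Y0 := Num.max Y (L / 4) in
  (Num.sqrt 2 - eps / 2) * L <= Y + (1 - rho) * L ^+ 2 / (2 * Y0) - rho * Y0.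
Proof.
move=> L0 Yge r0 r4 re /=; set s2 := Num.sqrt 2.
have s22 : s2 ^+ 2 = 2 by rewrite sqr_sqrtr.
have s20 : 0 <= s2 by exact: sqrtr_ge0.
have s2u : s2 <= 23 / 16.
  by rewrite -(@ler_pXn2r _ 2) ?nnegrE ?divr_ge0 // s22 expr_div_n ler_pdivlMr ?exprn_gt0 //
    -!natrX -natrM ler_nat.
case: (leP (L / 4) Y) => hY.
  have Y0 : 0 < Y by apply: lt_le_trans hY; rewrite divr_gt0.
  have h : s2 * L <= Y + L ^+ 2 / (2 * Y).
    rewrite -subr_ge0.
    have -> : Y + L ^+ 2 / (2 * Y) - s2 * L = (s2 * Y - L) ^+ 2 / (2 * Y).
      have -> : (s2 * Y - L) ^+ 2 = 2 * Y ^+ 2 - 2 * s2 * Y * L + L ^+ 2 by rewrite sqrrB exprMn s22; ring.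
      by field; rewrite gt_eqF.
    by rewrite divr_ge0 ?sqr_ge0 // mulr_ge0 // ltW.
  have -> : Y + (1 - rho) * L ^+ 2 / (2 * Y) - rho * Y =
      (1 - rho) * (Y + L ^+ 2 / (2 * Y)) by ring.
  apply: le_trans (ler_wpM2l _ h); last by lra.
  have : 2 * rho * L <= eps / 2 * L by rewrite ler_wpM2r ?(ltW L0) //; lra.
  have : rho * (s2 * L) <= rho * (2 * L).
    by rewrite ler_wpM2l ?(ltW r0) // ler_wpM2r ?(ltW L0) //; lra.
  lra.
have -> : (1 - rho) * L ^+ 2 / (2 * (L / 4)) = 2 * (1 - rho) * L.
  by field; rewrite gt_eqF.
have h1 : s2 * L <= 23 / 16 * L by rewrite ler_wpM2r ?(ltW L0).
have h2 : rho * L <= 4^-1 * L by rewrite ler_wpM2r ?(ltW L0).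
have h3 : 0 <= eps * L by rewrite mulr_ge0 ?(ltW L0) //; lra.
lra.
Qed.

End Growth.

(** * Choice of parameters in the upper bound *)

Section UpperAsymptotics.
Variable R : realType.
Implicit Types (l eps : R) (N p : nat).

Local Notation lnn n := (ln (n%:R : R)).

(** Rankin's method saves kappa x in the exponent, but the sum over primes is small only while
    p^kappa stays below sqrt x by a power of x. This dictates kappa close to l / (2 Y), and kappa x
    becomes nearly L^2 / (2 Y). Replacing Y by max (Y, L / 4) keeps kappa <= 1/4. Three errors of
    eps L / 6 join the eps L / 2 of [exponent_optimum]. *)
Lemma max_pdiv_sum_bound N p l L x rho beta eps :
    0 < rho -> rho <= 4^-1 -> 4 * rho <= eps -> beta = rho / 4 -> 1 <= l ->
    x = expR l -> lnn N = x -> L ^+ 2 = x * l -> (1 < p <= N)%N ->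
    l <= 8^-1 * L -> l <= expR (beta * l) -> ln 4 <= eps / 6 * L -> l <= eps / 6 * L ->
    48 * expR ((2^-1 - beta) * l) <= eps / 6 * L ->
    96 * expR 1 * expR (- (beta * l)) <= rho ->
  \sum_(2 <= n < N.+1 | max_pdiv n == p) (4 ^ Omega17 n)%:R
    <= expR (x - (Num.sqrt 2 - eps) * L).
Proof.
move=> r0 r4 re bE l1 xE lE LE /andP[p1 pN] f1 f2 f3 f4 f5 f6.
have p0 : (0 < p)%N by apply: ltnW.
have [Y YE] : exists Y, Y = lnn p by eexists.
have Y0 : 0 <= Y by rewrite YE lnn_ge0.
have Yx : Y <= x by rewrite YE -lE ler_ln ?posrE ?ltr0n ?ler_nat // (leq_trans p0).
have l0 := lt_le_trans ltr01 l1.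
have Lp : 0 < L by have := lt_le_trans l0 f1; rewrite pmulr_rgt0 ?invr_gt0 ?ltr0n.
have opt := @exponent_optimum R L Y rho eps Lp Y0 r0 r4 re.
set Ym := Num.max Y (L / 4) in opt; have YmL : L / 4 <= Ym by rewrite le_max lexx orbT.
have YmY : Y <= Ym by rewrite le_max lexx.
have Ym0 : 0 < Ym by apply: lt_le_trans YmL; rewrite divr_gt0.
rewrite /= -/Ym in opt; clearbody Ym.
have [kappa kE] : exists k, k = (1 - rho) * l / (2 * Ym) by eexists.
have th0 : 0 < 1 - rho by lra.
have k0 : 0 <= kappa by rewrite kE divr_ge0 ?mulr_ge0 ?(ltW th0) ?(ltW Ym0) //; lra.
have k4 : kappa <= 4^-1.
  rewrite kE ler_pdivrMr ?mulr_gt0 //.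
  have : (1 - rho) * l <= 1 * l by rewrite ler_wpM2r //; lra.
  lra.
(* The cut between small and large primes. As kappa w <= 1, the small ones cost O(w), which is at
   most rho Ym; dividing by w costs the large ones a factor expR (beta * l), and (1 - rho) / 2 +
   beta = 1/2 - beta. *)
have [w wE] : exists w, w = expR (- (beta * l)) * Ym by eexists.
have w0 : 0 < w by rewrite wE mulr_gt0 ?expR_gt0.
have kw : kappa * w <= 1.
  have -> : kappa * w = (1 - rho) / 2 * (l * expR (- (beta * l))).
    by rewrite kE wE; field; rewrite gt_eqF.
  have h : l * expR (- (beta * l)) <= 1.
    by rewrite expRN ler_pdivrMr ?expR_gt0 // mul1r.
  have h0 : 0 <= l * expR (- (beta * l)) by rewrite mulr_ge0 ?expR_ge0 //; lra.
  rewrite -[leRHS]mulr1; apply: ler_pM => //; lra.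
have kYm : kappa * Ym = (1 - rho) / 2 * l by rewrite kE; field; rewrite gt_eqF.
have kY : kappa * Y <= (1 - rho) / 2 * l by rewrite -kYm ler_wpM2l.
have ps : 12 * prime_sum kappa p <= rho * Ym + eps / 6 * L.
  apply: (@le_trans _ _ (12 * (8 * w * expR 1 +
      4 * expR ((2^-1 - beta) * l)))).
    rewrite ler_wpM2l //; apply: le_trans (prime_sum_le k0 w0 p1) _; rewrite -YE; apply: lerD.
      by rewrite ler_wpM2l ?ler_expR // mulr_ge0 // (ltW w0).
    rewrite ler_pdivrMr // -!mulrA ler_wpM2l // wE.
    have -> : expR ((2^-1 - beta) * l) * (expR (- (beta * l)) * Ym) =
        Ym * expR ((1 - rho) / 2 * l).
      rewrite mulrA -expRD mulrC; by congr (_ * expR _); rewrite bE; field.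
    by apply: ler_pM; rewrite ?expR_ge0 ?ler_expR.
  rewrite mulrDr; apply: lerD.
    have := ler_wpM2r (ltW Ym0) f6.
    by apply: le_trans; rewrite wE le_eqVlt; apply/orP; left; apply/eqP; ring.
  by rewrite mulrA (_ : 12 * 4 = 48) // -natrM.
have k14 : 0 <= kappa <= 4^-1 by rewrite k0.
apply: le_trans (sum_max_pdiv_le N p k14) _; rewrite lE -YE.
rewrite -[4 in leLHS](@lnK R) ?posrE // -expRD ler_expR.
have kx : kappa * x = (1 - rho) * L ^+ 2 / (2 * Ym).
  by rewrite kE LE; ring.
rewrite -kx in opt.
have -> : (1 - kappa) * (x - Y) = x - Y - kappa * x + kappa * Y by ring.
have : (1 - rho) / 2 * l <= l.
  by rewrite -[leRHS]mul1r ler_wpM2r //; lra.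
lra.
Qed.

Lemma near_max_pdiv_sum eps : 0 < eps -> \forall l \near +oo, forall N p,
  lnn N = expR l ->
  \sum_(2 <= n < N.+1 | max_pdiv n == p) (4 ^ Omega17 n)%:R
    <= expR (expR l - (Num.sqrt 2 - eps) * scale l).
Proof.
move=> e0.
have [rho [r0 r4 re]] : exists rho : R, [/\ 0 < rho, rho <= 4^-1 & 4 * rho <= eps].
  exists (Num.min (eps / 4) 4^-1); split.
    by rewrite lt_min divr_gt0 // invr_gt0 ltr0n.
    by rewrite ge_min lexx orbT.
  by rewrite mulrC -ler_pdivlMr // ge_min lexx.
have [beta bE] : exists beta, beta = rho / 4 by exists (rho / 4).
have b0 : 0 < beta by rewrite bE divr_gt0.
have e6 : 0 < eps / 6 by rewrite divr_gt0.
near=> l => N p lE.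
have l1 : 1 <= l by near: l; exact: near_ge.
have f1 : l <= 8^-1 * scale l by near: l; apply: near_le_scale; rewrite invr_gt0.
have f2 : l <= expR (beta * l).
  by rewrite -[leRHS]mul1r; near: l; exact: near_le_expR.
have f3 : ln 4 <= eps / 6 * scale l by near: l; exact: near_cst_le_scale.
have f4 : l <= eps / 6 * scale l by near: l; exact: near_le_scale.
have f5 : expR ((2^-1 - beta) * l) <= eps / 6 / 48 * scale l.
  by near: l; apply: near_power_le_scale; rewrite ?divr_gt0.
have f6 : expR (- (beta * l)) <= rho / (96 * expR 1).
  by near: l; apply: near_expR_neg; rewrite ?divr_gt0 ?mulr_gt0 ?expR_gt0.
have [/andP[p1 pN]|npN] := boolP ((1 < p)%N && (p <= N)%N); last first.
  rewrite big_nat_cond big1 ?expR_ge0 // => n /andP[/andP[n2 nN] /eqP np].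
  move: npN; rewrite -np prime_gt1 ?max_pdiv_prime //= => /negP[].
  by apply: leq_trans (nN : (n <= N)%N); apply: max_pdiv_leq; apply: leq_trans n2.
have LE : scale l ^+ 2 = expR l * l by rewrite sqr_scale // (le_trans ler01 l1).
apply: (max_pdiv_sum_bound r0 r4 re bE l1 erefl lE LE _ f1 f2 f3 f4).
- by rewrite p1.
- by move: f5; rewrite mulrAC ler_pdivlMr ?ltr0n // mulrC.
- by move: f6; rewrite ler_pdivlMr ?mulr_gt0 ?expR_gt0 ?ltr0n // mulrC.
Unshelve. all: by end_near. Qed.

Lemma Omega_le_ln N n : (0 < n <= N)%N -> (Omega n <= Num.truncn (2 * lnn N))%N.
Proof.
case/andP=> n0 nN; have N0 : (0 < N)%N by apply: leq_trans nN.
rewrite truncn_ge_nat ?mulr_ge0 ?lnn_ge0 //.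
have h : (2 ^ Omega n <= N)%N by apply: leq_trans (expn_Omega n0) nN.
have : lnn (2 ^ Omega n) <= lnn N by rewrite ler_ln ?posrE ?ltr0n ?expn_gt0 // ler_nat.
rewrite natrX lnXn // -(mulr_natr (ln _)).
have := ler_wpM2r (ler0n R (Omega n)) (ln2_ge_half R); lra.
Qed.

Lemma sqrt_expR_ln N x : (0 < N)%N -> lnn N = x -> Num.sqrt N%:R = expR (x / 2) :> R.
Proof.
move=> N0 lE; have -> : N%:R = expR (x / 2) ^+ 2 :> R.
  by rewrite -expRM_natr divfK // -lE expR_lnn.
by rewrite sqrtr_sqr ger0_norm ?expR_ge0.
Qed.

Lemma near_sidon_upper eps : 0 < eps -> \forall N \near \oo,
  sidon R N <= Num.sqrt N%:R *
    expR ((- (1 / Num.sqrt 2) + eps) * Num.sqrt (lnn N * ln (lnn N))).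
Proof.
move=> e0.
have H : \forall l \near +oo, forall N, lnn N = expR l -> (0 < N)%N ->
    sidon R N <= Num.sqrt N%:R * expR ((- (1 / Num.sqrt 2) + eps) * scale l).
  have C0 : 0 < 2 * (3 ^+ 17 * (Num.sqrt 8 * 16)) :> R.
    by rewrite !mulr_gt0 ?exprn_gt0 ?sqrtr_gt0.
  have e4 : 0 < eps / 4 by rewrite divr_gt0.
  near=> l => N lE N0.
  have VB : forall p, \sum_(2 <= n < N.+1 | max_pdiv n == p) (4 ^ Omega17 n)%:R
      <= expR (expR l - (Num.sqrt 2 - eps) * scale l).
    move=> p; have : forall N p, lnn N = expR l ->
      \sum_(2 <= n < N.+1 | max_pdiv n == p) (4 ^ Omega17 n)%:R
      <= expR (expR l - (Num.sqrt 2 - eps) * scale l).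
      by near: l; exact: near_max_pdiv_sum.
    by apply.
  have l1 : 1 <= l by near: l; exact: near_ge.
  have f1 : ln (2 * (3 ^+ 17 * (Num.sqrt 8 * 16))) <= eps / 4 * scale l.
    by near: l; exact: near_cst_le_scale.
  have f2 : l <= eps / 4 / 19 * scale l by near: l; apply: near_le_scale; rewrite divr_gt0.
  have f3 : scale l <= 4^-1 * expR l by near: l; apply: near_scale_le; rewrite invr_gt0.
  have f4 : 4 * ln 2 <= l by near: l; exact: near_ge.
  set L := scale l in VB f1 f2 f3 *; have L0 : 0 <= L by exact: scale_ge0.
  set x := expR l in lE VB f3 *.
  have x1 : 1 + l <= x by exact: expR_ge1Dx.
  have s2 : 1 / Num.sqrt 2 = Num.sqrt 2 / 2 :> R.
    have s0 : 0 < Num.sqrt 2 :> R by rewrite sqrtr_gt0.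
    apply: (mulIf (lt0r_neq0 s0)); rewrite mul1r mulVf ?lt0r_neq0 //.
    by rewrite mulrAC -expr2 sqr_sqrtr // divff.
  have sN := sqrt_expR_ln N0 lE.
  have s21 : 1 <= Num.sqrt 2 :> R by rewrite -{1}[1]sqrtr1 ler_wsqrtr // ler1n.
  have s2u : Num.sqrt 2 <= 2 :> R.
    by rewrite -(@ler_pXn2r _ 2) ?nnegrE ?sqrtr_ge0 // sqr_sqrtr // expr2; lra.
  rewrite sN -expRD s2; set T := x / 2 + _.
  (* Half of the target absorbs the summand 1 of [sidon_upper]; the other half is left for the main
     term. *)
  have T2 : 2 <= expR T.
    rewrite -[leLHS](@lnK R) ?posrE // ler_expR /T.
    have : 0 <= (2 - Num.sqrt 2) * L by rewrite mulr_ge0 //; lra.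
    have : 0 <= eps * L by rewrite mulr_ge0 // ltW.
    lra.
  have := sidon_upper N0 (fun n => @Omega_le_ln N n) VB.
  rewrite lE; set m := Num.truncn _; have m0 : 0 <= m%:R :> R by [].
  have mx : m%:R <= 2 * x by rewrite truncn_le mulr_ge0 // expR_ge0.
  move/le_trans; apply.
  suff : m.+1%:R ^+ 17 * (Num.sqrt 8 * Num.sqrt (expR (x - (Num.sqrt 2 - eps) * L)) *
      (4 * m%:R ^+ 2)) <= expR T / 2 by lra.
  rewrite ler_pdivlMr //.
  have sV : Num.sqrt (expR (x - (Num.sqrt 2 - eps) * L)) =
      expR ((x - (Num.sqrt 2 - eps) * L) / 2) :> R.
    rewrite -[x - _](@divfK _ 2) // [in LHS]expRM_natr.
    by rewrite sqrtr_sqr ger0_norm ?expR_ge0 // divfK.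
  (* From m <= 2 x and m + 1 <= 3 x. The power x^19 is exp (19 l), so [f1] and [f2] make the
     constant and this power cost eps L / 4 each. *)
  apply: (@le_trans _ _ (2 * (3 ^+ 17 * (Num.sqrt 8 * 16)) * x ^+ 19 *
      expR ((x - (Num.sqrt 2 - eps) * L) / 2))).
    rewrite sV; move: (expR ((x - _) / 2)) (expR_ge0 ((x - (Num.sqrt 2 - eps) * L) / 2)) => E E0.
    have q8 : 0 <= Num.sqrt 8 :> R by exact: sqrtr_ge0.
    have h1 : m.+1%:R ^+ 17 <= (3 * x) ^+ 17.
      by apply: lerXn2r; rewrite ?nnegrE ?ler0n ?mulr_ge0 ?expR_ge0 // -natr1; lra.
    have h2 : m%:R ^+ 2 <= (2 * x) ^+ 2.
      by apply: lerXn2r; rewrite ?nnegrE ?ler0n ?mulr_ge0 ?expR_ge0.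
    have h3 : m.+1%:R ^+ 17 * m%:R ^+ 2 <= (3 * x) ^+ 17 * (2 * x) ^+ 2.
      by apply: ler_pM; rewrite ?exprn_ge0.
    have -> : m.+1%:R ^+ 17 * (Num.sqrt 8 * E * (4 * m%:R ^+ 2)) * 2 =
      8 * Num.sqrt 8 * E * (m.+1%:R ^+ 17 * m%:R ^+ 2) by ring.
    have -> : 2 * (3 ^+ 17 * (Num.sqrt 8 * 16)) * x ^+ 19 * E =
      8 * Num.sqrt 8 * E * ((3 * x) ^+ 17 * (2 * x) ^+ 2).
      by rewrite !exprMn (_ : 19 = 17 + 2)%N // exprD; ring.
    by rewrite ler_wpM2l // !mulr_ge0.
  rewrite -[2 * (3 ^+ 17 * _)](@lnK R) ?posrE // /x -expRM_natl -!expRD ler_expR /T -/x; lra.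
have := near_lnln H; apply: filterS2; last first.
  exact: nbhs_infty_gt 2%N.
move=> N N2 /(_ N).
have N0 : (0 < N)%N by apply: leq_trans N2.
have lN : 0 < lnn N by rewrite ln_gt0 // ltr1n; apply: leq_trans N2.
rewrite /scale lnK ?posrE // => HN; exact: HN.
Unshelve. all: by end_near. Qed.

End UpperAsymptotics.

(** * Choice of parameters in the lower bound *)

Section LowerAsymptotics.
Variable R : realType.
Implicit Types (l eps delta L x c G : R) (N y K i : nat).

Local Notation lnn n := (ln (n%:R : R)).

(** Subtract the upper Mertens bound up to y^(1 - delta) from the lower one up to y. With K large
    the leading terms differ by at least (delta / 2) ln y, and the bounded terms use up at most half
    of that. *)
Lemma mertens_window K y delta : (1 < K)%N -> (0 < y)%N -> 0 < delta -> delta <= 1 ->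
    K%:R / K.-1%:R * (1 - delta) <= 1 - delta / 2 ->
    3 + K%:R / K.-1%:R * lnn K <= delta / 4 * lnn y ->
  delta / 4 * lnn y <=
    \sum_(1 <= q < y.+1 | prime q && ((1 - delta) * lnn y < lnn q)) lnn q / q%:R.
Proof.
move=> K1 y0 d0 d1 HK Hy; set Z := (1 - delta) * lnn y.
have Z0 : 0 <= Z by rewrite mulr_ge0 ?lnn_ge0 // subr_ge0.
pose n := Num.truncn (expR Z).
have n0 : (0 < n)%N.
  by rewrite truncn_gt0; apply: le_trans (expR_ge1Dx _); rewrite lerDl.
have nZ : lnn n <= Z.
  by rewrite -[leRHS]expRK ler_ln ?posrE ?ltr0n ?expR_gt0 // truncn_le expR_ge0.
have ny : (n <= y)%N.
  rewrite -(ler_nat R) -ler_ln ?posrE ?ltr0n //; apply: le_trans nZ _.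
  by rewrite -[leRHS]mul1r ler_wpM2r ?lnn_ge0 // gerBl ltW.
have := mertens_lower R y0; rewrite (bigID (fun q => (1 - delta) * lnn y < lnn q)) /= -/Z.
have low : \sum_(1 <= q < y.+1 | prime q && ~~ (Z < lnn q)) lnn q / q%:R
    <= K%:R / K.-1%:R * (lnn n + lnn K).
  apply: le_trans (mertens_upper R K1 n0).
  rewrite (@big_cat_nat _ _ _ n.+1) //= [X in _ + X]big_nat_cond.
  rewrite [X in _ + X]big1 ?addr0 => [|q /andP[/andP[nq _] /andP[pq]]].
    rewrite big_mkcondr; apply: ler_sum => q _; case: ifP => // _.
    by rewrite divr_ge0 ?ler0n ?lnn_ge0.
  rewrite -leNgt => qZ; have : (q <= n)%N.
    rewrite truncn_ge_nat ?expR_ge0 // -(expR_lnn R (prime_gt0 pq)) ler_expR.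
    exact: qZ.
  by rewrite leqNgt nq.
have KK : 0 <= K%:R / K.-1%:R :> R by rewrite divr_ge0 ?ler0n.
have h1 : K%:R / K.-1%:R * (lnn n + lnn K) <= K%:R / K.-1%:R * (Z + lnn K).
  by rewrite ler_wpM2l // lerD2r.
have h2 : K%:R / K.-1%:R * Z <= (1 - delta / 2) * lnn y.
  by rewrite /Z mulrA ler_wpM2r ?lnn_ge0.
move: low h1 h2 Hy; rewrite !mulrDr.
move: (\sum_(_ <= _ < _ | _) _) (\sum_(_ <= _ < _ | _) _) => S1 S2.
move: (K%:R / K.-1%:R * lnn n) (K%:R / K.-1%:R * lnn K) (K%:R / K.-1%:R * Z).
by move=> A B C; clear; lra.
Qed.

(** About x / ln y steps are taken, each losing a factor of order ln y / x, roughly exp (- l / 2).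
    The total exponent is near x l / (2 c L) = L / (2 c), which is c L because 2 c^2 = 1. *)
Lemma Psi_asymptotic N y K l L x c delta :
    0 < delta -> delta <= 4^-1 -> (1 < K)%N ->
    K%:R / K.-1%:R * (1 - delta) <= 1 - delta / 2 ->
    1 <= l -> x = expR l -> lnn N = x -> L ^+ 2 = x * l -> expR (l / 2) <= L ->
    L <= x -> (1 < N)%N -> (0 < y)%N ->
    0 < c -> c <= 1 -> 2 * c ^+ 2 = 1 ->
    (1 - delta) * (c * L) <= lnn y -> lnn y <= c * L -> L / 4 <= lnn y ->
    3 + K%:R / K.-1%:R * lnn K <= delta / 16 * L ->
    ln 32 - ln delta <= delta / 2 * l -> l <= delta * L ->
  expR (x - c * L - 10 * delta * L) <= Psi R y N.
Proof.
move=> d0 d4 K1 HK l1 xE lE LE Ll Lx N1 y0 c0 c1 cc Gl Gu G4 HL Hd lL.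
have l0 := lt_le_trans ltr01 l1.
have L0 : 0 < L := lt_le_trans (expR_gt0 _) Ll.
have x0 : 0 < x by rewrite xE expR_gt0.
have G0 : 0 < lnn y by apply: lt_le_trans G4; rewrite divr_gt0.
have d1 : 0 < 1 - delta by move: d4; clear; lra.
have Z0 : 0 < (1 - delta) * lnn y by rewrite mulr_gt0.
have W : delta / 4 * lnn y <=
    \sum_(1 <= q < y.+1 | prime q && ((1 - delta) * lnn y < lnn q)) lnn q / q%:R.
  have dl1 : delta <= 1 by move: d4; clear; lra.
  have HL' : 3 + K%:R / K.-1%:R * lnn K <= delta / 4 * lnn y.
    by apply: le_trans HL _; move: (ler_wpM2l (ltW d0) G4); clear; lra.
  exact: (mertens_window K1 y0 d0 dl1 HK HL').
pose om := delta / 8 * (lnn y / x); pose i := (Num.truncn (x / ((1 - delta) * lnn y))).+1.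
have om0 : 0 < om by rewrite !mulr_gt0 ?invr_gt0.
have yx : lnn y <= x.
  by apply: le_trans Gu (le_trans _ Lx); rewrite -[leRHS]mul1r ler_wpM2r // ltW.
have om1 : om <= 1.
  rewrite -[leRHS]mulr1; apply: ler_pM; rewrite ?ler_pdivrMr ?mul1r ?(ltW d0) //.
  - by rewrite divr_ge0 // ltW.
  - by rewrite divr_ge0 // ltW.
  - by move: d4; clear; lra.
have omx : om * (2 * lnn N) = delta / 4 * lnn y.
  by rewrite lE /om; field; rewrite gt_eqF.
have iZ : lnn N <= lnn y + i%:R * ((1 - delta) * lnn y).
  rewrite lE; apply: (@le_trans _ _ (i%:R * ((1 - delta) * lnn y))); last by rewrite lerDr ltW.
  by rewrite -ler_pdivrMr // ltW // truncnS_gt.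
have N0 : (0 < N <= N)%N by rewrite leqnn andbT ltnW.
have o01 : 0 <= om <= 1 by rewrite (ltW om0).
have lN : 0 < lnn N by rewrite lE.
have omW := W; rewrite -omx in omW.
have := Psi_lower o01 lN omW N0 y0 iZ; apply: le_trans.
rewrite -(expR_lnn R (ltnW N1)) lE -[om](@lnK R) ?posrE // -expRM_natl -expRD ler_expR.
have lnG : l / 2 - ln 4 <= ln (lnn y).
  have -> : l / 2 - ln 4 = ln (expR (l / 2) / 4).
    by rewrite ln_div ?posrE ?expR_gt0 // expRK.
  rewrite ler_ln ?posrE ?divr_gt0 ?expR_gt0 //.
  by apply: le_trans G4; rewrite ler_wpM2r ?invr_ge0.
have omE : - ln om <= l / 2 * (1 + delta).
  have -> : ln om = ln delta - ln 8 + (ln (lnn y) - l).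
    rewrite /om lnM ?posrE ?divr_gt0 // ln_div ?posrE // ln_div ?posrE //.
    by rewrite xE expRK.
  have : ln 32 = ln 8 + ln 4 :> R by rewrite -lnM ?posrE // -natrM.
  by move: lnG Hd; clear; lra.
have ix : i%:R <= x / ((1 - delta) * lnn y) + 1.
  by rewrite /i -natr1 lerD2r truncn_le divr_ge0 // ltW.
(* Apart from delta this is x l / (c L) = 2 c L. Two factors 1 - delta are lost, one from the window
   and one from the lower bound for [lnn y]; (1 + 6 delta) (1 - delta)^2 >= 1 makes up for both. *)
have xZ : x / ((1 - delta) * lnn y) * l <= 2 * c * (1 + 6 * delta) * L.
  rewrite mulrAC -LE ler_pdivrMr //.
  apply: (@le_trans _ _ (2 * c * (1 + 6 * delta) * L * ((1 - delta) * ((1 - delta) * (c * L))))); last first.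
    rewrite ler_wpM2l //; first by rewrite !mulr_ge0 ?(ltW c0) ?(ltW L0) //; move: d0; clear; lra.
    by rewrite ler_wpM2l // ltW.
  have -> : 2 * c * (1 + 6 * delta) * L * ((1 - delta) * ((1 - delta) * (c * L))) =
      (1 + 6 * delta) * (1 - delta) ^+ 2 * (2 * c ^+ 2 * L ^+ 2) by ring.
  rewrite cc mul1r -[leLHS]mul1r ler_wpM2r ?sqr_ge0 //.
  have -> : (1 + 6 * delta) * (1 - delta) ^+ 2 =
     1 + delta * (4 - 11 * delta + 6 * delta ^+ 2) by ring.
  rewrite lerDl mulr_ge0 ?(ltW d0) //.
  by have := sqr_ge0 delta; move: d4; clear; lra.
have i0 : 0 <= i%:R :> R by [].
have e1 : i%:R * - ln om <= i%:R * (l / 2 * (1 + delta)) by rewrite ler_wpM2l.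
have ld0 : 0 <= l / 2 * (1 + delta).
  by rewrite mulr_ge0 // ?divr_ge0 ?(ltW l0) // addr_ge0 // ltW.
have e2 : i%:R * (l / 2 * (1 + delta)) <=
    (x / ((1 - delta) * lnn y) + 1) * (l / 2 * (1 + delta)) by rewrite ler_wpM2r.
have e3 : (x / ((1 - delta) * lnn y) * l) * ((1 + delta) / 2) <=
    2 * c * (1 + 6 * delta) * L * ((1 + delta) / 2).
  by rewrite ler_wpM2r // divr_ge0 // addr_ge0 // ltW.
have e4 : l / 2 * (1 + delta) <= l.
  have := ler_wpM2l (ltW l0) d4; move: l0; clear; lra.
have e5 : c * (1 + 6 * delta) * (1 + delta) * L <= c * L + 9 * delta * L.
  have h1 : delta * delta <= delta * 4^-1 by rewrite ler_wpM2l // ltW.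
  have h2 : c * (delta * L) <= delta * L by rewrite ler_piMl // mulr_ge0 // ltW.
  have -> : c * (1 + 6 * delta) * (1 + delta) * L =
    c * L + 7 * (c * (delta * L)) + 6 * (delta * delta * (c * L)) by ring.
  have h3 : delta * delta * (c * L) <= delta * 4^-1 * (c * L).
    by rewrite ler_wpM2r // mulr_ge0 // ltW.
  have h4 : 0 <= delta * L by rewrite mulr_ge0 // ltW.
  move: h2 h3 h4; clear; lra.
have e6 : (x / ((1 - delta) * lnn y) + 1) * (l / 2 * (1 + delta)) =
    x / ((1 - delta) * lnn y) * l * ((1 + delta) / 2) + l / 2 * (1 + delta) by ring.
move: e1 e2 e3 e4 e5 lL; rewrite e6 mulrN.
move: (i%:R * ln om) (i%:R * _) (x / _ * l * _) (l / 2 * _) => A B C D.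
clear; lra.
Qed.

(** In Psi / (18 y ln N) the exponent loses c L twice, once through Psi and once through y, so the
    square root has exponent x / 2 - c L up to errors bounded by eps L. *)
Lemma sidon_lower_exponent N y x l L c delta eps :
    x = expR l -> lnn N = x -> (1 < N)%N -> (0 < y)%N -> lnn y <= c * L -> 0 < c -> c <= 1 ->
    0 < L -> 0 < delta -> delta <= 4^-1 -> 10 * delta <= eps ->
    expR (x - c * L - 10 * delta * L) <= Psi R y N ->
    ln 72 <= L -> l <= L -> L <= 10^-1 * x -> ln 18 / 2 + ln 8 <= eps / 4 * L ->
    l <= eps / 4 * L ->
  expR (x / 2 + (- c - eps) * L) <= sidon R N.
Proof.
move=> xE lE N1 y0 Gu c0 c1 L0 d0 d4 de HP f1 f2 f3 f4 f5.
have x0 : 0 < x by rewrite xE expR_gt0.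
have yp : 0 < y%:R :> R by rewrite ltr0n.
have cL : c * L <= L by rewrite ler_piMl // ltW.
have dL : delta * L <= 4^-1 * L by rewrite ler_wpM2r // ltW.
have yxE : y%:R * lnn N <= expR (c * L + l).
  by rewrite lE xE expRD; apply: ler_pM; rewrite ?expR_ge0 ?ler0n // -(expR_lnn R y0) ler_expR.
have yx0 : 0 < y%:R * lnn N by rewrite mulr_gt0 // lE.
have H72 : 72 * (y%:R * lnn N) <= Psi R y N.
  apply: le_trans HP; apply: (@le_trans _ _ (72 * expR (c * L + l))); first by rewrite ler_wpM2l.
  rewrite -[72 in leLHS](@lnK R) ?posrE // -expRD ler_expR.
  by move: f1 f2 f3 cL dL x0; clear; lra.
apply: le_trans (sidon_lower N1 y0 H72).
pose E := x - c * L - 10 * delta * L - (ln 18 + (c * L + l)).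
have EP : expR E <= Psi R y N / (18 * (y%:R * lnn N)).
  have y18 : 0 < 18 * (y%:R * lnn N) by apply: mulr_gt0.
  rewrite ler_pdivlMr //; apply: le_trans HP.
  rewrite /E expRB; move: (expR (x - _ - _)) (expR_ge0 (x - c * L - 10 * delta * L)) => A A0.
  rewrite mulrAC ler_pdivrMr ?expR_gt0 // ler_wpM2l //.
  by rewrite expRD lnK ?posrE // ler_wpM2l.
apply: (@le_trans _ _ (Num.sqrt (expR E) / 8)); last first.
  by rewrite ler_wpM2r ?invr_ge0 // ler_wsqrtr.
have -> : Num.sqrt (expR E) = expR (E / 2) :> R.
  rewrite -{1}[E](@divfK _ 2) // expRM_natr.
  by rewrite sqrtr_sqr ger0_norm ?expR_ge0.
rewrite -[8 in leRHS](@lnK R) ?posrE // -expRB ler_expR /E.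
have : 10 * delta * L <= eps * L by rewrite ler_wpM2r // ltW.
have : 0 <= 10 * delta * L by rewrite !mulr_ge0 // ltW.
by move: f4 f5; clear; lra.
Qed.

Lemma near_sidon_lower eps : 0 < eps -> \forall N \near \oo,
  Num.sqrt N%:R *
    expR ((- (1 / Num.sqrt 2) - eps) * Num.sqrt (lnn N * ln (lnn N))) <= sidon R N.
Proof.
move=> e0.
have [delta [d0 d4 de]] : exists delta : R, [/\ 0 < delta, delta <= 4^-1 & 10 * delta <= eps].
  exists (Num.min (eps / 10) 4^-1); split.
  - by rewrite lt_min divr_gt0 // invr_gt0 ltr0n.
  - by rewrite ge_min lexx orbT.
  - by rewrite mulrC -ler_pdivlMr // ge_min lexx.
have [K K1 HK] : exists2 K, (1 < K)%N & K%:R / K.-1%:R * (1 - delta) <= 1 - delta / 2.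
  (* With k = K - 1 > 2 / delta, (1 + 1/k) (1 - delta) <= 1 - delta + 1/k <= 1 - delta / 2. *)
  exists (Num.truncn (2 / delta)).+2 => //=.
  have := truncnS_gt (2 / delta); set k := (Num.truncn _).+1 => hk.
  have k0 : 0 < k%:R :> R by rewrite ltr0n.
  have kd : k%:R^-1 <= delta / 2.
    by rewrite -[leRHS]invrK lef_pV2 ?posrE ?invr_gt0 ?divr_gt0 // invf_div ltW.
  have -> : k.+1%:R / k%:R = 1 + k%:R^-1 :> R by rewrite -natr1 mulrDl divff ?gt_eqF // mul1r.
  have : k%:R^-1 * (1 - delta) <= k%:R^-1.
    by rewrite ler_piMr ?invr_ge0 ?ler0n // gerBl ltW.
  by rewrite mulrDl; move: kd; clear; lra.
have s0 : 0 < Num.sqrt 2 :> R by rewrite sqrtr_gt0.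
have [c [cE c0 c1 cc]] : exists c : R, [/\ c = 1 / Num.sqrt 2, 0 < c, c <= 1 & 2 * c ^+ 2 = 1].
  exists (1 / Num.sqrt 2); split.
  - by [].
  - exact: divr_gt0.
  - by rewrite ler_pdivrMr // mul1r -[leLHS]sqrtr1 ler_wsqrtr // ler1n.
  - by rewrite expr_div_n sqr_sqrtr // expr1n mul1r divff.
have c2 : 2^-1 <= c.
  have : c ^+ 2 <= c by rewrite expr2 ler_piMl // ltW.
  by move: cc; clear; lra.
rewrite -cE.
have H : \forall l \near +oo, forall N, lnn N = expR l -> (1 < N)%N ->
    Num.sqrt N%:R * expR ((- c - eps) * scale l) <= sidon R N.
  have d2 : 0 < delta / 2 by rewrite divr_gt0.
  have d16 : 0 < delta / 16 by rewrite divr_gt0.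
  have e4 : 0 < eps / 4 by rewrite divr_gt0.
  near=> l => N lE N1.
  have l1 : 1 <= l by near: l; exact: near_ge.
  have f1 : scale l <= 10^-1 * expR l by near: l; apply: near_scale_le; rewrite invr_gt0.
  have f2 : ln 2 <= delta / 2 * scale l by near: l; exact: near_cst_le_scale.
  have f3 : ln 2 <= 4^-1 * scale l by near: l; apply: near_cst_le_scale; rewrite invr_gt0.
  have f4 : 3 + K%:R / K.-1%:R * lnn K <= delta / 16 * scale l.
    by near: l; exact: near_cst_le_scale.
  have f5 : (ln 32 - ln delta) / (delta / 2) <= l by near: l; exact: near_ge.
  have f6 : l <= delta * scale l by near: l; exact: near_le_scale.
  have f7 : ln 72 <= 1 * scale l by near: l; exact: near_cst_le_scale.
  have f8 : ln 18 / 2 + ln 8 <= eps / 4 * scale l by near: l; exact: near_cst_le_scale.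
  have f9 : l <= eps / 4 * scale l by near: l; exact: near_le_scale.
  have l0 := lt_le_trans ltr01 l1.
  have LE := sqr_scale (ltW l0); have Ll := expR_half_le_scale l1.
  have L0 := lt_le_trans (expR_gt0 _) Ll.
  move: f1 f2 f3 f4 f6 f7 f8 f9 LE Ll L0; rewrite ler_pdivrMr // mulrC in f5.
  move: (scale l) => L f1 f2 f3 f4 f6 f7 f8 f9 LE Ll L0.
  have Lx : L <= expR l.
    apply: le_trans f1 _; rewrite ler_piMl ?expR_ge0 // invf_le1 ?ler1n //.
  have lL : l <= L by apply: le_trans f6 _; rewrite ler_piMl ?(ltW L0) //; move: d4; clear; lra.
  pose y := Num.truncn (expR (c * L)).
  have cL0 : 0 < c * L by rewrite mulr_gt0.
  have y0 : (0 < y)%N by rewrite truncn_gt0; apply: le_trans (expR_ge1Dx _); rewrite lerDl ltW.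
  have Gu : lnn y <= c * L.
    by rewrite -[leRHS]expRK ler_ln ?posrE ?ltr0n ?expR_gt0 // truncn_le expR_ge0.
  have Gd : c * L - ln 2 <= lnn y.
    rewrite lerBlDr -lnM ?posrE ?ltr0n // -[leLHS]expRK ler_ln ?posrE ?expR_gt0 ?mulr_gt0 ?ltr0n //.
    apply: le_trans (ltW (truncnS_gt _)) _; rewrite -/y -natrM ler_nat.
    by rewrite muln2 -addnn -addn1 leq_add2l.
  have cL2 : 2^-1 * L <= c * L by rewrite ler_wpM2r // ltW.
  have Gl : (1 - delta) * (c * L) <= lnn y.
    apply: le_trans Gd; have := ler_wpM2l (ltW d0) cL2; move: f2; clear; lra.
  have G4 : L / 4 <= lnn y by apply: le_trans Gd; move: f3 cL2; clear; lra.
  have HP := Psi_asymptotic d0 d4 K1 HK l1 erefl lE LE Ll Lx N1 y0 c0 c1 cc Gl Gu G4 f4 f5 f6.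
  rewrite mul1r in f7.
  rewrite (sqrt_expR_ln (ltnW N1) lE) -expRD.
  exact: (sidon_lower_exponent erefl lE N1 y0 Gu c0 c1 L0 d0 d4 de HP f7 lL f1 f8 f9).
have := near_lnln H; apply: filterS2; last first.
  exact: nbhs_infty_gt 2%N.
move=> N N2 /(_ N).
have lN : 0 < lnn N by rewrite ln_gt0 // ltr1n; apply: leq_trans N2.
rewrite /scale lnK ?posrE // => HN; apply: HN => //.
by apply: leq_trans N2.
Unshelve. all: by end_near. Qed.

End LowerAsymptotics.

Theorem theorem3 (R : realType) :
  exists eps : nat -> R,
    eps N @[N --> \oo] --> (0 : R) /\
    \forall N \near \oo,
      sidon R N = Num.sqrt N%:R *
        expR ((- (1 / Num.sqrt 2) + eps N) *
              Num.sqrt (ln N%:R * ln (ln N%:R))).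
Proof.
pose L N : R := Num.sqrt (ln N%:R * ln (ln N%:R)).
(* The asserted identity solved for the error term. It is meaningful once L N and the Sidon constant
   are positive, which holds for all large N. *)
pose eps N := ln (sidon R N / Num.sqrt N%:R) / L N + 1 / Num.sqrt 2.
have L0 : \forall N \near \oo, 0 < L N.
  have := near_lnln (near_ge (1 : R)); apply: filterS2; last exact: nbhs_infty_gt 2%N.
  move=> N N2 l1; rewrite /L sqrtr_gt0 mulr_gt0 ?(lt_le_trans ltr01 l1) //.
  by rewrite ln_gt0 // ltr1n; apply: leq_trans N2.
have lower e : 0 < e -> \forall N \near \oo,
    Num.sqrt N%:R * expR ((- (1 / Num.sqrt 2) - e) * L N) <= sidon R N.
  exact: near_sidon_lower.
have upper e : 0 < e -> \forall N \near \oo,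
    sidon R N <= Num.sqrt N%:R * expR ((- (1 / Num.sqrt 2) + e) * L N).
  exact: near_sidon_upper.
exists eps; split; last first.
  near=> N.
  have N0 : (0 < N)%N by near: N; exact: nbhs_infty_gt.
  have sN : 0 < Num.sqrt N%:R :> R by rewrite sqrtr_gt0 ltr0n.
  have LN : 0 < L N by near: N.
  have lo : Num.sqrt N%:R * expR ((- (1 / Num.sqrt 2) - 1) * L N) <= sidon R N.
    by near: N; exact: lower.
  have S0 : 0 < sidon R N by apply: lt_le_trans lo; rewrite mulr_gt0 ?expR_gt0.
  rewrite -/(L N) /eps addrCA addNr addr0 divfK ?gt_eqF // lnK ?posrE ?divr_gt0 //.
  by rewrite mulrC divfK ?gt_eqF.
apply/cvgrPdist_le => e e0; near=> N.
have N0 : (0 < N)%N by near: N; exact: nbhs_infty_gt.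
have sN : 0 < Num.sqrt N%:R :> R by rewrite sqrtr_gt0 ltr0n.
have LN : 0 < L N by near: N.
have lo : Num.sqrt N%:R * expR ((- (1 / Num.sqrt 2) - e) * L N) <= sidon R N.
  by near: N; exact: lower.
have up : sidon R N <= Num.sqrt N%:R * expR ((- (1 / Num.sqrt 2) + e) * L N).
  by near: N; exact: upper.
have S0 : 0 < sidon R N by apply: lt_le_trans lo; rewrite mulr_gt0 ?expR_gt0.
have q0 : 0 < sidon R N / Num.sqrt N%:R by rewrite divr_gt0.
have h1 : - (1 / Num.sqrt 2) - e <= ln (sidon R N / Num.sqrt N%:R) / L N.
  rewrite ler_pdivlMr // -[leLHS]expRK ler_ln ?posrE ?expR_gt0 //.
  by rewrite ler_pdivlMr // mulrC.
have h2 : ln (sidon R N / Num.sqrt N%:R) / L N <= - (1 / Num.sqrt 2) + e.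
  rewrite ler_pdivrMr // -[leRHS]expRK ler_ln ?posrE ?expR_gt0 //.
  by rewrite ler_pdivrMr // mulrC.
rewrite sub0r normrN ler_norml /eps.
move: h1 h2; move: (ln _ / _) (1 / Num.sqrt 2) => u v; clear; lra.
Unshelve. all: by end_near. Qed.
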